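(* Let $r\ge 1$. Assume that the mesh size $h$ of the partition $\mathcal P$ is sufficiently small (no quasi-uniformity of $\mathcal P$ is assumed). Then $$\inf_{0\ne v\in U^r_{\mathcal P}}\ \sup_{0\neq w\in V_{\mathcal P'}}\frac{a_{\mathcal P}(v,w)}{\|v\|_{1,\mathcal P}\,\|w\|_{\mathcal P'}}\ \ge\ c_0 ,$$ where $c_0>0$ is a constant depending only on $r,\alpha_0,\kappa$ and $\Omega$ (in particular not on $\mathcal P$).
   Context: Coefficients. $\Omega=(a,b)$ is a bounded interval, and $\alpha,\beta,\gamma\in L^\infty(\bar\Omega)$ are real functions defined on $[a,b]$, with $\beta$ weakly differentiable, satisfying $\alpha\ge\alpha_0>0$ (pointwise) and $\gamma-\tfrac12\beta'\ge\kappa>0$. They are the coefficients of the problem $-(\alpha u')'+\beta u'+\gamma u=f$ on $\Omega$, $u(a)=u(b)=0$. Primal mesh. For $a=x_0<x_1<\dots<x_N=b$ put $\tau_i=[x_{i-1},x_i]$, $h_i=x_i-x_{i-1}$, $h=\max_i h_i$, $\mathcal P=\{\tau_i\}_{i=1}^N$. The trial space is $U^r_{\mathcal P}=\{v\in C([a,b]): v|_{\tau_i}$ is a polynomial of degree $\le r$ for each $i$, $v(a)=v(b)=0\}$. For piecewise smooth $v$, $\|v\|_{1,\mathcal P}^2=\sum_i\big(\|v\|_{L^2(\tau_i)}^2+\|v'\|_{L^2(\tau_i)}^2\big)$. Dual mesh. Let $G_1<\dots<G_r$ be the zeros in $[-1,1]$ of the Legendre polynomial of degree $r$; $g_{i,j}=\tfrac12(x_i+x_{i-1}+h_iG_j)$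 for $1\le i\le N$, $1\le j\le r$, and $g_{i,r+1}=g_{i+1,1}$ for $1\le i\le N-1$. Put $r_i=r$ for $i\le N-1$ and $r_N=r-1$. The test space $V_{\mathcal P'}$ consists of $w=\sum_{i=1}^N\sum_{j=1}^{r_i}w_{i,j}\chi_{[g_{i,j},g_{i,j+1}]}$, $w_{i,j}\in\mathbb R$ (functions vanishing on $[a,g_{1,1}]$ and $[g_{N,r},b]$). With the conventions $w_{1,0}=0$, $w_{N,r}=0$, $w_{i,0}=w_{i-1,r}$ ($2\le i\le N$), the jumps are $[w_{i,j}]=w_{i,j}-w_{i,j-1}$ for $1\le i\le N$, $1\le j\le r$. The norm is $$\|w\|_{\mathcal P'}^2=\sum_{i=1}^N\sum_{j=1}^r h_i^{-1}[w_{i,j}]^2+\sum_{i=1}^N\sum_{j=1}^{r_i}h_iw_{i,j}^2 .$$ Bilinear form. $$a_{\mathcal P}(v,w)=\sum_{i=1}^N\sum_{j=1}^r[w_{i,j}]\,\alpha(g_{i,j})v'(g_{i,j})+\sum_{i=1}^N\sum_{j=1}^{r_i}w_{i,j}\int_{g_{i,j}}^{g_{i,j+1}}\big(\beta v'+\gamma v\big)\,dx .$$ ''$h$ sufficiently small'' means $h\le h_0$ for a threshold $h_0>0$ that may depend on $r,\Omega,\alpha,\beta,\gamma$. *)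

(* Defs.v *)
From HB Require Import structures.
From mathcomp Require Import all_boot all_order all_algebra polyrcf.
From mathcomp Require Import all_classical all_reals all_analysis.

Set Implicit Arguments.
Unset Strict Implicit.
Unset Printing Implicit Defensive.

Import Order.TTheory GRing.Theory Num.Theory.
Import numFieldNormedType.Exports.

Local Open Scope classical_set_scope.
Local Open Scope ring_scope.

Section Coefficients.
Context {R : realType}.
Implicit Types (a b : R) (f phi : R -> R).

Notation mu := (@lebesgue_measure R).

(* [Lfun] only contains Borel functions; passing to almost-everywhere equal
   functions yields all Lebesgue measurable ones. *)
Definition Linfty a b f : Prop :=
  exists2 g : R -> R, (g \_ `[a, b]) \in Lfun mu +oo%E &
    {ae mu, forall t, t \in `[a, b] -> f t = g t}.

Definition test_function a b phi : Prop :=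
  let supp := closure [set t | phi t != 0] in
  [/\ forall n t, derivable (derive1n n phi) t 1, compact supp
    & supp `<=` `]a, b[].

Definition weak_derivative a b f df : Prop :=
  locally_integrable `]a, b[ df /\
  forall phi, test_function a b phi ->
    \int[mu]_(t in `]a, b[) (f t * derive1 phi t) =
    - \int[mu]_(t in `]a, b[) (df t * phi t).

End Coefficients.

Section FiniteVolume.
Context {R : realType}.

Notation mu := (@lebesgue_measure R).

(* Rodrigues' formula *)
Definition legendre (r : nat) : {poly R} :=
  (2 ^+ r * (r`!)%:R)^-1 *: derivn r (('X^2 - 1) ^+ r).

Definition legendre_zeros (r : nat) : seq R :=
  [seq t <- rootsR (legendre r) | -1 <= t <= 1].

(* Meshes and coefficient families are indexed by [nat] and only their values
   on the ranges 0..N, 1..N and 1..r are ever used. Numbering of cells and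
   of Gauss points starts at 1. *)
Definition gauss_ref (r j : nat) : R := nth 0 (legendre_zeros r) j.-1.

Definition is_mesh (a b : R) (N : nat) (x : nat -> R) : Prop :=
  [/\ x 0%N = a, x N = b & forall i, (i < N)%N -> x i < x i.+1].

Variables (r N : nat) (x : nat -> R).
Implicit Types (i j : nat) (v : R -> R) (w : nat -> nat -> R).

Definition cell_size i : R := x i - x i.-1.

Definition mesh_size : R := \big[Num.max/0]_(1 <= i < N.+1) cell_size i.

Definition trial_space : set (R -> R) :=
  [set v | [/\ {within `[x 0%N, x N], continuous v},
     forall i, (0 < i <= N)%N -> exists2 p : {poly R}, (size p <= r.+1)%N &
       {in `[x i.-1, x i], forall t, v t = p.[t]},
     v (x 0%N) = 0 & v (x N) = 0]].

(* Trial functions are functions on [a, b]: values elsewhere are irrelevant. *)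
Definition trial_nonzero v : Prop := exists2 t, t \in `[x 0%N, x N] & v t != 0.

(* [derive1 v] carries no information at the nodes, a null set. *)
Definition trial_norm v : R :=
  Num.sqrt (\sum_(1 <= i < N.+1)
    (\int[mu]_(t in `[x i.-1, x i]) (v t ^+ 2) +
     \int[mu]_(t in `[x i.-1, x i]) (derive1 v t ^+ 2))).

Definition gauss_in_cell i j : R :=
  2^-1 * (x i + x i.-1 + cell_size i * gauss_ref r j).

Definition gauss i j : R :=
  if j == r.+1 then gauss_in_cell i.+1 1 else gauss_in_cell i j.

Definition ncoef i : nat := if i == N then r.-1 else r.

(* An element of the test space is given by its coefficients w i j,
   1 <= i <= N, 1 <= j <= ncoef i. *)
Definition test_fun w (t : R) : R :=
  \sum_(1 <= i < N.+1) \sum_(1 <= j < (ncoef i).+1)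
    w i j * \1_(`[gauss i j, gauss i j.+1]) t.

Definition test_nonzero w : Prop := exists t, test_fun w t != 0.

Definition ext_coef w i j : R :=
  if j == 0%N then (if i == 1%N then 0 else w i.-1 r)
  else if (i == N) && (j == r) then 0 else w i j.

Definition jump w i j : R := ext_coef w i j - ext_coef w i j.-1.

Definition test_norm w : R :=
  Num.sqrt (\sum_(1 <= i < N.+1) \sum_(1 <= j < r.+1)
              (cell_size i)^-1 * jump w i j ^+ 2 +
            \sum_(1 <= i < N.+1) \sum_(1 <= j < (ncoef i).+1)
              cell_size i * w i j ^+ 2).

Definition bilinear_form (alpha beta gamma : R -> R) v w : R :=
  \sum_(1 <= i < N.+1) \sum_(1 <= j < r.+1)
    jump w i j * (alpha (gauss i j) * derive1 v (gauss i j)) +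
  \sum_(1 <= i < N.+1) \sum_(1 <= j < (ncoef i).+1)
    w i j * \int[mu]_(t in `[gauss i j, gauss i j.+1])
              (beta t * derive1 v t + gamma t * v t).

Definition inf_sup (alpha beta gamma : R -> R) : \bar R :=
  ereal_inf [set ereal_sup [set (bilinear_form alpha beta gamma v w /
                                 (trial_norm v * test_norm w))%:E
                            | w in test_nonzero]
            | v in trial_space `&` trial_nonzero].

End FiniteVolume.

(* Main.v *)
(* The trial function [v] is tested against the step function [lift v] whose
   jump at a Gauss point is the Gauss weight times the value of [v'] there.
   Since Gauss quadrature is exact in degree [2r - 1], the jumps of [lift v]
   over a cell add up to the increment of [v], so [lift v] vanishes at both ends
   and agrees with [v] at the nodes; moreover the diffusion part of the bilinear
   form is at least [alpha0 * |v'|^2]. On each cell, [lift v - v] is bounded by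
   [2 h^(1/2) |v'|], so that up to [O(h)] the convection-reaction part is the
   integral of [v (beta v' + gamma v)], which is at least [kappa * |v|^2].

   As [beta'] is only locally integrable, this last bound is obtained from the
   inequality [beta' <= 2 (gamma - kappa)] tested against nonnegative smooth
   functions converging to [v^2], in which the pieces of [v^2] are glued by
   smooth steps at slightly displaced nodes. *)

(* Two difficulties shape the proof. First, [beta'] need not be integrable up to the end points, so
   limits of integrals containing it are out of reach: the weak formulation removes [beta'] while
   the test function is still smooth, and the limit involves bounded integrands only. The derivative
   of the smoothed [v^2] stays bounded because neighbouring pieces agree at their common node: the
   zero of their difference compensates the slope [1/eps] of the step. Second, the threshold is
   fixed before [alpha0] and [kappa], which costs a factor 2 in [c0 = min(alpha0, kappa) / (4 sqrt(1
   + 8 r))]; the other factor 2 absorbs the [O(h)] error. All estimates are local to a cell and rest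
   on exactness of the quadrature, not on inverse inequalities, so sizes of different cells are
   never compared. *)
Require Import Defs.
From mathcomp Require Import all_boot all_order all_algebra.
From mathcomp Require Import polyorder polyrcf cauchyreals qpoly.
From mathcomp Require Import all_classical all_reals all_analysis.
From mathcomp Require Import ring lra zify.
From mathcomp Require Import measurable_realfun ess_sup_inf.

Import Order.TTheory GRing.Theory Num.Theory.
Import numFieldNormedType.Exports.

Local Open Scope classical_set_scope.
Local Open Scope ring_scope.

(** * Gauss quadrature *)

Section Quadrature.
Context {R : realType}.
Implicit Types (p q s Q : {poly R}) (c d : R).

(* The constant coefficient is a division by zero, hence [0]. *)
Definition prim p : {poly R} := \poly_(i < (size p).+1) (p`_i.-1 / i%:R).

Lemma deriv_prim p : (prim p)^`() = p.
Proof.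
apply/polyP => i; rewrite coef_deriv coef_poly ltnS /=.
have [ip|pi] := ltnP i (size p); last by rewrite mul0rn nth_default.
by rewrite -[LHS]mulr_natr divfK // pnatr_eq0.
Qed.

Lemma size_prim p : (size (prim p) <= (size p).+1)%N.
Proof. exact: size_poly. Qed.

Lemma deriv_eq0 p : p^`() = 0 -> p = (p`_0)%:P.
Proof.
move=> p0; apply/size1_polyC.
by have := size_deriv p; rewrite p0 size_poly0; case: (size p) => [|[]].
Qed.

Lemma horner_deriv0 p c d : p^`() = 0 -> p.[d] - p.[c] = 0.
Proof. by move=> /deriv_eq0 ->; rewrite !hornerC subrr. Qed.

(** The integral of [p] from [c] to [d], kept algebraic so that the quadrature identities need no
    measure theory; [Rintegral_horner] links it to the Lebesgue integral. *)
Definition pint p c d := (prim p).[d] - (prim p).[c].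

Lemma pint_deriv p c d : pint p^`() c d = p.[d] - p.[c].
Proof.
apply/eqP; rewrite -subr_eq0; apply/eqP.
rewrite -(horner_deriv0 (prim p^`() - p) c d) ?derivB ?deriv_prim ?subrr //.
by rewrite /pint !hornerE; ring.
Qed.

Lemma pintE p Q c d : Q^`() = p -> pint p c d = Q.[d] - Q.[c].
Proof. by move=> <-; exact: pint_deriv. Qed.

Lemma pintD p q c d : pint (p + q) c d = pint p c d + pint q c d.
Proof.
by rewrite (pintE _ (prim p + prim q)) ?derivD ?deriv_prim // /pint !hornerD; ring.
Qed.

Lemma pintZ k p c d : pint (k *: p) c d = k * pint p c d.
Proof.
by rewrite (pintE _ (k *: prim p)) ?derivZ ?deriv_prim // /pint !hornerZ; ring.
Qed.

Lemma pintN p c d : pint (- p) c d = - pint p c d.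
Proof. by rewrite -scaleN1r pintZ mulN1r. Qed.

Lemma pintC k c d : pint k%:P c d = k * (d - c).
Proof.
rewrite (pintE _ (k *: 'X)) ?derivZ ?derivX ?alg_polyC // !hornerE; ring.
Qed.

Lemma pint_cat p c e d : pint p c e + pint p e d = pint p c d.
Proof. by rewrite /pint; ring. Qed.

Lemma pint_ge0 p c d : c <= d -> (forall t, c < t < d -> 0 <= p.[t]) ->
  0 <= pint p c d.
Proof.
move=> cd p0; rewrite subr_ge0; apply: (@ler_hornerW _ c d) => //.
- by move=> t; rewrite in_itv /= deriv_prim; exact: p0.
- by rewrite in_itv /= lexx cd.
- by rewrite in_itv /= lexx cd.
Qed.

Lemma pint_sum (I : Type) (r : seq I) (P : pred I) (F : I -> {poly R}) c d :
  pint (\sum_(i <- r | P i) F i) c d = \sum_(i <- r | P i) pint (F i) c d.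
Proof.
apply: (big_morph (fun p => pint p c d)) => [p q|]; first exact: pintD.
by rewrite (_ : 0 = 0%:P) // pintC mul0r.
Qed.

(** Rolle's theorem between consecutive zeros. The strict bounds by the outer zeros are recorded so
    that the end points can be adjoined again for the next derivative. *)
Lemma rolle_path p c (s : seq R) :
  path <%R c s -> all (root p) (c :: s) ->
  exists t, [/\ size t = size s, path <%R c t
    & all (fun y => root p^`() y && (y < last c s)) t].
Proof.
elim: s c => [|e s IHs] c /=; first by exists [::].
move=> /andP[ce es] /and3P[pc pe ps].
have [y /[!in_itv]/= /andP[cy ye] p'y] : {y | y \in `]c, e[ & p^`().[y] = 0}.
  by apply: poly_rolle => //; rewrite (rootP pc) (rootP pe).
have [|t [st et /allP at_]] := IHs _ es; first by rewrite /= pe.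
exists (y :: t); split; rewrite /= ?st //.
  rewrite cy /=; case: t {st at_} et => [//|z t] /= /andP[ez ->].
  by rewrite (lt_trans ye ez).
apply/andP; split; last exact/allP.
rewrite /root p'y eqxx /= (lt_le_trans ye) //.
case: s es {ps IHs st at_} => //= z s /andP[ez]; rewrite (lt_path_sortedE) => /andP[/allP zs _].
rewrite (le_trans (ltW ez)) //; case/lastP: s zs => //= s u zs.
by rewrite last_rcons ltW // zs // mem_rcons inE eqxx.
Qed.

Lemma dvdp_exp_deriv p c n :
  (('X - c%:P) ^+ n.+1 %| p)%R -> (('X - c%:P) ^+ n %| p^`())%R.
Proof.
move=> /dvdpP[q ->]; rewrite derivM deriv_exp /=; apply: dvdp_add.
  by rewrite exprS mulrA dvdp_mulIr.
by rewrite -mulrnAl mulrA dvdp_mulIr.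
Qed.

Definition rodrigues r : {poly R} := ('X^2 - 1) ^+ r.

Lemma rodriguesE r :
  rodrigues r = ('X - 1%:P) ^+ r * ('X - (-1)%:P) ^+ r.
Proof. by rewrite /rodrigues -exprMn; congr (_ ^+ _); rewrite polyCN; ring. Qed.

Lemma size_rodrigues r : size (rodrigues r) = (r.*2).+1.
Proof.
rewrite rodriguesE size_Mmonic ?expf_neq0 ?polyXsubC_eq0 //; last exact/monic_exp/monicXsubC.
by rewrite !size_exp_XsubC addSn addnS /= addnn.
Qed.

(** Both end points are zeros of order [r], and each differentiation lowers the order by one. These
    zeros feed the Rolle argument and cancel the boundary terms of the integrations by parts. *)
Lemma derivn_rodrigues_bnd r k : (k < r)%N ->
  root (rodrigues r)^`(k) 1 && root (rodrigues r)^`(k) (-1).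
Proof.
move=> kr; have H c : (('X - c%:P) ^+ r %| rodrigues r)%R ->
    root (rodrigues r)^`(k) c.
  move=> dc; rewrite root_factor_theorem.
  suff: (('X - c%:P) ^+ (r - k) %| (rodrigues r)^`(k))%R.
    by apply: dvdp_trans; rewrite -(subnSK kr) exprS dvdp_mulIl.
  elim: k kr => [|k IHk] kr; first by rewrite subn0.
  by rewrite derivnS; apply: dvdp_exp_deriv; rewrite subnSK ?(ltnW kr) //; apply/IHk/ltnW.
by rewrite !H // rodriguesE ?dvdp_mulIl ?dvdp_mulIr.
Qed.

(** The [k] interior zeros together with -1 and 1 bound [k + 1] gaps, and Rolle's theorem gives a
    zero of the next derivative in each. *)
Lemma derivn_rodrigues_roots r k : (k <= r)%N ->
  exists t, [/\ size t = k, path <%R (-1) t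
    & all (fun y => root (rodrigues r)^`(k) y && (y < 1)) t].
Proof.
elim: k => [|k IHk] kr; first by exists [::].
have [t [st pt at_]] := IHk (ltnW kr).
have /andP[r1 rN1] := derivn_rodrigues_bnd r k kr.
have [|/=|u [su pu au]] := @rolle_path (rodrigues r)^`(k) (-1) (rcons t 1).
- rewrite rcons_path pt /=.
  case/lastP: t {st pt} at_ => [|t y] /=; first by move=> _; lra.
  by rewrite all_rcons last_rcons => /andP[/andP[_ ->]].
- by rewrite rN1 all_rcons r1 /=; apply: sub_all at_ => y /andP[].
by exists u; rewrite su size_rcons st derivnS; split=> //; rewrite last_rcons in au.
Qed.

Lemma size_derivn_rodrigues r : size (rodrigues r)^`(r) = r.+1.
Proof. by rewrite size_derivn size_rodrigues -addnn -addSn addnK. Qed.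

Lemma legendreE r : exists2 k, k != 0 & legendre r = k *: (rodrigues r)^`(r).
Proof.
exists (2 ^+ r * r`!%:R)^-1 => //.
Qed.

(** The [r] zeros supplied by Rolle exhaust the degree, so the filtered root list has the same
    members; strictly sorted lists with the same members coincide. *)
Lemma legendre_zerosP r :
  [/\ size (@legendre_zeros R r) = r, path <%R (-1) (@legendre_zeros R r)
    & all (fun y => root (rodrigues r)^`(r) y && (y < 1)) (@legendre_zeros R r)].
Proof.
have [t [st pt at_]] := derivn_rodrigues_roots r r (leqnn r).
suff -> : @legendre_zeros R r = t by [].
have [k k0 Lk] := legendreE r.
have L0 : legendre r != 0 :> {poly R}.
  by rewrite Lk scaler_eq0 negb_or k0 -size_poly_eq0 size_derivn_rodrigues.
have memL (y : R) : (y \in rootsR (legendre r)) = root (legendre r) y :> bool.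
  by have := roots_on_rootsR L0 y; rewrite /= => ->.
have uniqt : uniq t := sorted_uniq lt_trans ltxx (path_sorted pt).
apply: lt_sorted_eq; last first.
- move=> y; rewrite mem_filter memL Lk rootZ //.
  apply/andP/idP => [[_ ry]|yt]; last first.
    have /andP[-> y1] := allP at_ _ yt; split=> //.
    by rewrite !ltW // (allP (order_path_min lt_trans pt)).
  apply: contraT => yt.
  suff : (size (y :: t) < size (rodrigues r)^`(r))%N.
    by rewrite size_derivn_rodrigues /= st ltnn.
  apply: max_poly_roots; rewrite /= ?yt //.
    by rewrite -size_poly_eq0 size_derivn_rodrigues.
  by rewrite ry; apply: sub_all at_ => z /andP[].
- exact: path_sorted pt.
- apply: sorted_filter; [exact: lt_trans | exact: sorted_roots].
Qed.

Lemma gauss_ref_bnd r j : (0 < j <= r)%N -> -1 < @gauss_ref R r j < 1.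
Proof.
have [sz pz az] := legendre_zerosP r; case: j => //= j jr.
have zj : @gauss_ref R r j.+1 \in @legendre_zeros R r by rewrite mem_nth ?sz.
by have /andP[_ ->] := allP az _ zj; rewrite (allP (order_path_min lt_trans pz)).
Qed.

Lemma gauss_ref_lt r j : (0 < j < r)%N -> @gauss_ref R r j < @gauss_ref R r j.+1.
Proof.
have [sz pz az] := legendre_zerosP r; case: j => //= j jr.
by apply: (sorted_ltn_nth lt_trans 0 (path_sorted pz)); rewrite ?inE ?sz // ltnW.
Qed.

(** Orthogonality of the Legendre polynomial to lower degrees, the integral being expressed through
    an antiderivative [Q]. Each integration by parts lowers the order of the derivative and the
    degree of [s], until [s] is zero. *)
Lemma rodrigues_orthogonal r s Q : (size s <= r)%N ->
  Q^`() = (rodrigues r)^`(r) * s -> Q.[1] = Q.[-1].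
Proof.
suff H k : (k <= r)%N -> forall s Q, (size s <= k)%N ->
  Q^`() = (rodrigues r)^`(k) * s -> Q.[1] = Q.[-1] by exact: (H r).
elim: k => [|k IHk] kr {}s {}Q sk.
  move: sk; rewrite leqn0 size_poly_eq0 => /eqP -> /=; rewrite mulr0 => Q0.
  by apply/eqP; rewrite -subr_eq0 horner_deriv0.
rewrite derivnS => Q'.
have /andP[/rootP r1 /rootP rN1] := derivn_rodrigues_bnd r k kr.
have := IHk (ltnW kr) s^`() ((rodrigues r)^`(k) * s - Q).
rewrite !hornerE r1 rN1 !mul0r !add0r => H; apply: oppr_inj; apply: H.
  by rewrite size_deriv; case: (size s) sk.
by rewrite derivB derivM Q'; ring.
Qed.

(* [qpoly.lagrange_gen] wants sampling points indexed injectively by all of nat. *)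
Let node r k : R := if (k < r)%N then (@legendre_zeros R r)`_k else k.+1%:R.

(** The padding values [k.+1%:R] are at least 1, hence above all zeros. *)
Let node_inj r : injective (node r).
Proof.
have [sz pz /allP az] := legendre_zerosP r.
have lt1 k : (k < r)%N -> (@legendre_zeros R r)`_k < 1.
  by move=> kr; have /az/andP[] : (@legendre_zeros R r)`_k \in legendre_zeros r
    by rewrite mem_nth ?sz.
have ge1 k : 1 <= k.+1%:R :> R by rewrite ler1n.
move=> i j; rewrite /node; case: ltnP => ir; case: ltnP => jr.
- move=> /eqP; rewrite nth_uniq ?sz // ; first by move/eqP.
  exact: (sorted_uniq lt_trans ltxx (path_sorted pz)).
- by move=> E; have := lt1 _ ir; rewrite E ltNge ge1.
- by move=> E; have := lt1 _ jr; rewrite -E ltNge ge1.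
- by move=> /eqP; rewrite eqr_nat eqSS => /eqP.
Qed.

(** The weights integrate the Lagrange basis. Dividing the derivative of [Q] by the Legendre
    polynomial leaves a quotient that orthogonality kills and a remainder that interpolation
    integrates exactly. Stating the rule for a derivative makes the integral an increment of [Q]. *)
Lemma gauss_quadrature r : (0 < r)%N -> exists A : nat -> R,
  (forall j, 0 <= A j) /\
  forall Q, (size Q <= r.*2.+1)%N ->
    \sum_(1 <= j < r.+1) A j * Q^`().[@gauss_ref R r j] = Q.[1] - Q.[-1].
Proof.
move=> r0.
pose l := tnth (r.-lagrange (node r)); pose w i : R := pint (l i) (-1) 1.
have lE (i j : 'I_r) : (l i : {poly R}).[node r j] = (i == j)%:R.
  exact: lagrange_sample (node_inj r) i j.
have exact Q : (size Q <= r.*2.+1)%N ->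
    \sum_(i < r) w i * Q^`().[node r i] = Q.[1] - Q.[-1].
  move=> sQ; set L := (rodrigues r)^`(r).
  have sL : size L = r.+1 := size_derivn_rodrigues r.
  have L0 : L != 0 by rewrite -size_poly_eq0 sL.
  have Lnode (i : 'I_r) : L.[node r i] = 0.
    have [sz _ /allP az] := legendre_zerosP r; apply/rootP.
    rewrite /node ltn_ord.
    by have /az/andP[] : (@legendre_zeros R r)`_i \in legendre_zeros r
      by rewrite mem_nth ?sz.
  have Qdiv := divp_eq Q^`() L.
  have smod : (size (Q^`() %% L)%R <= r)%N by rewrite -ltnS -sL ltn_modp.
  have sdiv : (size (Q^`() %/ L)%R <= r)%N.
    by rewrite size_divp // sL size_deriv /= leq_subLR addnn; case: (size Q) sQ.
  rewrite -(pint_deriv Q) Qdiv pintD.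
  have -> : pint (Q^`() %/ L * L) (-1) 1 = 0.
    apply/eqP; rewrite subr_eq0; apply/eqP.
    by apply: rodrigues_orthogonal sdiv _; rewrite deriv_prim mulrC.
  rewrite add0r [in RHS](lagrange_gen r0 (node_inj r) smod) pint_sum.
  apply: eq_bigr => i _.
  by rewrite mul_polyC pintZ mulrC hornerD hornerM Lnode mulr0 add0r.
have w0 i : 0 <= w i.
  pose li : {poly R} := l i.
  have sli : size li = r by rewrite /li /l size_lagrange_ //; exact: node_inj.
  (* Exactness applies to the squared basis polynomial, of degree [2r - 2], and only its own node
     contributes. *)
  have -> : w i = pint (li ^+ 2) (-1) 1.
    have := exact (prim (li ^+ 2)).
    rewrite deriv_prim -/(pint (li ^+ 2) (-1) 1) => <-.
      rewrite (bigD1 i) //= big1 => [|j ji]; rewrite horner_exp lE.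
        by rewrite eqxx expr1n mulr1 addr0.
      by rewrite eq_sym (negPf ji) expr0n mulr0.
    rewrite (leq_trans (size_prim _)) // ltnS.
    by rewrite expr2 (leq_trans (size_mul_leq _ _)) // sli -addnn; lia.
  by apply: pint_ge0 => [|t _]; [lra | rewrite horner_exp sqr_ge0].
exists (fun j => if insub j.-1 is Some i then w i else 0); split=> [j|Q sQ].
  by case: insubP.
rewrite big_add1 /= big_mkord -exact //; apply: eq_bigr => i _.
by rewrite valK /gauss_ref /node ltn_ord.
Qed.

End Quadrature.

(** * Smooth step functions *)

Section SmoothFunctions.
Context {R : realType}.
Implicit Types (p : {poly R}) (f g : R -> R).

(** The polynomial factor in [1/t] makes the family stable under differentiation, which [exp(-1/t)]
    alone is not. *)
Definition flat p (t : R) : R := if 0 < t then p.[t^-1] * expR (- t^-1) else 0.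

Lemma horner_expR_bound p : exists C : R, 0 <= C /\
  forall s, 1 <= s -> `|p.[s]| <= C * expR s.
Proof.
exists (\sum_(i < size p) `|p`_i| * (i.+1)`!%:R); split.
  by apply: sumr_ge0 => i _; rewrite mulr_ge0.
move=> s s1; have s0 : 0 <= s by lra.
rewrite horner_coef mulr_suml (le_trans (ler_norm_sum _ _ _)) //.
apply: ler_sum => i _; rewrite normrM -mulrA ler_wpM2l //.
rewrite ger0_norm ?exprn_ge0 //.
have := expR_ge1Dxn i s0; rewrite addrC -lerBDr => H.
have : s ^+ i.+1 / (i.+1)`!%:R <= expR s by lra.
rewrite ler_pdivrMr ?ltr0n ?fact_gt0 // mulrC; apply: le_trans.
by rewrite exprS ler_peMl ?exprn_ge0.
Qed.

(** The exponential bound is applied to [p * 'X^2] at [1/h]: the extra square becomes the factor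
    [h^2], which makes the difference quotient at 0 vanish. *)
Lemma flat_bound p : exists C : R, 0 <= C /\
  forall h, `|h| <= 1 -> `|flat p h| <= C * h ^+ 2.
Proof.
have [C [C0 pC]] := horner_expR_bound (p * 'X^2).
exists C; split=> // h h1; rewrite /flat; case: ltP => h0; last first.
  by rewrite normr0 mulr_ge0 ?sqr_ge0.
have hV : 1 <= h^-1 by rewrite invf_ge1 // -[h]gtr0_norm.
have := pC _ hV; rewrite hornerM hornerXn expRN normrM.
rewrite (gtr0_norm (_ : 0 < h^-1 ^+ 2)) ?exprn_gt0 ?invr_gt0 // => H.
rewrite normrM (gtr0_norm (_ : 0 < (expR h^-1)^-1)) ?invr_gt0 ?expR_gt0 //.
rewrite ler_pdivrMr ?expR_gt0 //; move: H.
by rewrite exprVn ler_pdivrMr ?exprn_gt0 // mulrAC.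
Qed.

Lemma is_derive_flat0 f (C : R) : 0 <= C -> f 0 = 0 ->
  (forall h, `|h| <= 1 -> `|f h| <= C * h ^+ 2) -> is_derive (0 : R) 1 f 0.
Proof.
move=> C0 f0 fC; have H : h^-1 *: (f (h *: 1 + 0) - f 0) @[h --> 0^'] --> (0 : R).
  apply/cvgrPdist_le => /= e e0.
  near=> h; rewrite f0 subr0 addr0 sub0r normrN -[h *: 1]/(h * 1) mulr1.
  rewrite -[_ *: _]/(_ * _) normrM normfV.
  have hn0 : h != 0 by near: h; exact: nbhs_dnbhs_neq.
  rewrite mulrC ler_pdivrMr ?normr_gt0 //.
  have h1 : `|h| <= 1 by near: h; apply: dnbhs0_le; exact: ltr01.
  have h2 : `|h| <= e / (C + 1).
    by near: h; apply: dnbhs0_le; rewrite divr_gt0 //; lra.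
  apply: le_trans (fC _ h1) _.
  rewrite -[h ^+ 2]real_normK ?num_real // expr2 mulrA ler_wpM2r //.
  apply: le_trans (ler_wpM2l C0 h2) _.
  by rewrite mulrA ler_pdivrMr; nra.
apply: DeriveDef; first by apply/cvg_ex; exists 0.
by rewrite /derive; apply: cvg_lim.
Unshelve. all: by end_near. Qed.

Lemma is_derive_near f g (x df : R) : {near x, f =1 g} ->
  is_derive x 1 f df -> is_derive x 1 g df.
Proof.
move=> fg [fx <-]; apply: DeriveDef; first exact: near_eq_derivable fx.
by symmetry; apply: near_eq_derive.
Qed.

(** With [s = 1/t], differentiation in [t] is [-s^2 d/ds], and [d/ds] sends [p e^(-s)] to
    [(p' - p) e^(-s)]. *)
Lemma is_derive_flat p (t : R) :
  is_derive t 1 (flat p) (flat ('X^2 * (p - p^`())) t).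
Proof.
have [t0|t0|->] := ltgtP t 0.
- apply: (@is_derive_near (cst 0)); last first.
    by rewrite /flat ltNge (ltW t0) /=; exact: is_derive_cst.
  by near=> s; rewrite /flat ltNge ltW //=; near: s; exact: lt_nbhsl.
- apply: (@is_derive_near (fun s => p.[s^-1] * expR (- s^-1))).
    by near=> s; rewrite /flat ifT //; near: s; exact: lt_nbhsr.
  have tn0 : t != 0 by rewrite gt_eqF.
  have dV : is_derive t 1 (fun s : R => s^-1) (- t ^- 2).
    by have := @is_deriveV R id t 1 1 tn0 (is_derive_id _ _);
      rewrite -[_ *: _]/(_ * _) mulr1.
  have dp := is_derive1_comp (is_derive_poly p t^-1) dV.
  have dNV : is_derive t 1 (fun s : R => - s^-1) (- - t ^- 2) := is_deriveN dV.
  have de := @is_derive1_comp R expR (fun s => - s^-1) t _ _ (is_derive_expR _) dNV.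
  rewrite [X in is_derive _ _ _ X](_ : _ = p.[t^-1] * (expR (- t^-1) * - - t ^- 2)
      + expR (- t^-1) * (p^`().[t^-1] * - t ^- 2)); first exact: (is_deriveM dp de).
  by rewrite /flat t0 hornerM hornerXn hornerD hornerN; field.
- have [C [C0 pC]] := flat_bound p.
  rewrite [X in is_derive _ _ _ X]/flat ltxx.
  by apply: (is_derive_flat0 _ _ C0 _ pC); rewrite /flat ltxx.
Unshelve. all: by end_near. Qed.

(** A grammar closed under differentiation: derivatives of all orders, as test functions require,
    follow by iterating a single first-order computation. *)
Inductive smooth : (R -> R) -> Prop :=
| smooth_horner p : smooth (horner p)
| smooth_flat p : smooth (flat p)
| smooth_add f g : smooth f -> smooth g -> smooth (fun t => f t + g t)
| smooth_mul f g : smooth f -> smooth g -> smooth (fun t => f t * g t)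
| smooth_inv f : (forall t, f t != 0) -> smooth f -> smooth (fun t => (f t)^-1)
| smooth_comp f g : smooth f -> smooth g -> smooth (f \o g).

Lemma smooth_cst (k : R) : smooth (cst k).
Proof.
suff -> : cst k = horner k%:P by exact: smooth_horner.
by apply/funext => t; rewrite hornerC.
Qed.

Lemma smooth_is_derive f : smooth f ->
  exists2 g, smooth g & forall t : R, is_derive t 1 f (g t).
Proof.
elim=> {f} [p|p|f g sf [f' sf' df] sg [g' sg' dg]|f g sf [f' sf' df] sg [g' sg' dg]
  |f f0 sf [f' sf' df]|f g sf [f' sf' df] sg [g' sg' dg]].
- exists (horner p^`()); [exact: smooth_horner | exact: is_derive_poly].
- by exists (flat ('X^2 * (p - p^`()))); [exact: smooth_flat | exact: is_derive_flat].
- exists (fun t => f' t + g' t); first exact: smooth_add.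
  by move=> t; exact: is_deriveD.
- exists (fun t => f t * g' t + g t * f' t).
    by apply: smooth_add; apply: smooth_mul.
  by move=> t; have := is_deriveM (df t) (dg t).
- exists (fun t => (-1) * ((f t)^-1 * (f t)^-1) * f' t).
    do 2?[apply: smooth_mul => //]; first exact: smooth_cst.
    by apply: smooth_mul; exact: smooth_inv.
  move=> t; apply: (is_derive_eq (is_deriveV (f0 t) (df t))).
  by rewrite -[_ *: _]/(_ * _) expr2 invfM; ring.
- exists (fun t => f' (g t) * g' t); last first.
    by move=> t; have := is_derive1_comp (df (g t)) (dg t).
  exact: (smooth_mul _ _ (smooth_comp _ _ sf' sg) sg').
Qed.

Lemma smooth_derive1 f : smooth f -> smooth (derive1 f).
Proof.
move=> /smooth_is_derive[g sg df]; suff -> : derive1 f = g by [].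
by apply/funext => t; rewrite derive1E; have /@derive_val -> := df t.
Qed.

Lemma smooth_derivable f n (t : R) : smooth f -> derivable (derive1n n f) t 1.
Proof.
move=> sf; have : smooth (derive1n n f).
  by elim: n => // n IHn; rewrite derive1nS; exact: smooth_derive1.
by move=> /smooth_is_derive[g _ /(_ t)] [].
Qed.

Lemma smooth_continuous f : smooth f -> continuous f.
Proof.
move=> sf t; apply: differentiable_continuous; apply/derivable1_diffP.
exact: (@smooth_derivable f 0).
Qed.

Lemma smooth_sum (I : Type) (r : seq I) (P : pred I) (F : I -> R -> R) :
  (forall i, smooth (F i)) -> smooth (fun t => \sum_(i <- r | P i) F i t).
Proof.
move=> sF; elim: r => [|i r IHr].
  by under eq_fun do rewrite big_nil; exact: smooth_cst.
under eq_fun do rewrite big_cons; case: (P i) => //.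
exact: smooth_add.
Qed.

Lemma flat1_ge0 t : 0 <= flat 1 t.
Proof. by rewrite /flat; case: ifP => // _; rewrite hornerC mul1r expR_ge0. Qed.

Lemma flat1_gt0 t : 0 < t -> 0 < flat 1 t.
Proof. by rewrite /flat => ->; rewrite hornerC mul1r expR_gt0. Qed.

Lemma flat1_eq0 t : t <= 0 -> flat 1 t = 0.
Proof. by rewrite /flat leNgt => /negPf ->. Qed.

Lemma flat1_homo : {homo flat 1 : s t / s <= t}.
Proof.
move=> s t st; have [s0|s0] := ltP 0 s; last by rewrite flat1_eq0 ?flat1_ge0.
have t0 : 0 < t by lra.
by rewrite /flat s0 t0 !hornerC !mul1r ler_expR lerN2 lef_pV2.
Qed.

(** The standard smooth transition from 0 to 1 on the unit interval; its denominator is positive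
    because [t] or [1 - t] is. *)
Definition step t : R := flat 1 t * (flat 1 t + flat 1 (1 - t))^-1.

Lemma step_denom_gt0 t : 0 < flat 1 t + flat 1 (1 - t).
Proof.
have [t0|t0] := ltP 0 t; first by rewrite ltr_pwDl ?flat1_gt0 ?flat1_ge0.
by rewrite ltr_wpDl ?flat1_gt0 ?flat1_ge0 //; lra.
Qed.

Lemma smooth_step : smooth step.
Proof.
apply: smooth_mul; first exact: smooth_flat.
apply: smooth_inv => [t|]; first by rewrite gt_eqF ?step_denom_gt0.
apply: smooth_add; first exact: smooth_flat.
suff -> : (fun t => flat 1 (1 - t)) = flat 1 \o horner (1 - 'X).
  by apply: smooth_comp; [exact: smooth_flat | exact: smooth_horner].
by apply/funext => t /=; rewrite !hornerE.
Qed.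

Lemma step0 t : t <= 0 -> step t = 0.
Proof. by move=> t0; rewrite /step flat1_eq0 // mul0r. Qed.

Lemma step1 t : 1 <= t -> step t = 1.
Proof.
move=> t1; rewrite /step [flat 1 (1 - t)]flat1_eq0; last by lra.
by rewrite addr0 divff // gt_eqF // flat1_gt0 //; lra.
Qed.

(** After cross-multiplication, monotonicity of [flat 1] suffices. This is what later keeps the
    smoothed functions nonnegative. *)
Lemma step_homo : {homo step : s t / s <= t}.
Proof.
move=> s t st; rewrite /step ler_pdivrMr ?step_denom_gt0 // mulrAC.
rewrite ler_pdivlMr ?step_denom_gt0 //.
have := flat1_homo _ _ st; have : flat 1 (1 - t) <= flat 1 (1 - s).
  by apply: flat1_homo; lra.
have := flat1_ge0 s; have := flat1_ge0 t; have := flat1_ge0 (1 - t).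
have := flat1_ge0 (1 - s); nra.
Qed.

Lemma step_derive : exists (step' : R -> R) (C : R),
  [/\ forall t : R, is_derive t 1 step (step' t), forall t : R, `|step' t| <= C
    & forall t : R, t < 0 \/ 1 < t -> step' t = 0].
Proof.
have [step' sstep' dstep] := smooth_is_derive _ smooth_step.
have step'0 (t : R) : t < 0 \/ 1 < t -> step' t = 0.
  move=> t01; have /@derive_val <- := dstep t.
  suff /@derive_val : is_derive t 1 step 0 by [].
  case: t01 => t0.
    apply: (@is_derive_near (cst 0)).
    by near=> s; rewrite step0 // ltW //; near: s; exact: lt_nbhsl.
  apply: (@is_derive_near (cst 1)).
  by near=> s; rewrite step1 // ltW //; near: s; exact: lt_nbhsr.
have [|c _ cmax] := @EVT_max R (fun t => `|step' t|) 0 1 ler01.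
  apply: continuous_subspaceT => t.
  by apply: continuous_comp; [exact: smooth_continuous | exact: norm_continuous].
exists step', `|step' c|; split=> // t.
have [t0|t0] := ltP t 0; first by rewrite step'0 ?normr0 //; left.
have [t1|t1] := ltP 1 t; first by rewrite step'0 ?normr0 //; right.
by apply: cmax; rewrite in_itv /= t0.
Unshelve. all: by end_near. Qed.

End SmoothFunctions.

(** * Integrals of bounded functions *)

Section IntegralAe.
Context d (T : measurableType d) (R : realType) (mu : {measure set T -> \bar R}).
Implicit Types (f g : T -> R) (D N : set T).

Local Open Scope ereal_scope.
Import HBNNSimple.

(** Valid for nonmeasurable functions: the integral is a supremum over simple functions below [f],
    and setting such a function to 0 on [N] keeps its integral and puts it below [g]. *)
Lemma ge0_le_integral_off_null (f g : T -> \bar R) N :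
  measurable N -> mu N = 0 -> (forall x, 0 <= f x) -> (forall x, 0 <= g x) ->
  (forall x, ~ N x -> f x = g x) -> \int[mu]_x f x <= \int[mu]_x g x.
Proof.
move=> mN N0 f0 g0 fg; rewrite [leLHS]ge0_integralTE //.
apply: ge_ereal_sup => _ [h hf <-].
rewrite -integralT_nnsfun (ge0_negligible_integral mN) //; last 2 first.
- by apply/measurable_EFinP; exact: measurable_funPT.
- by move=> x _; rewrite lee_fin.
rewrite setTD integral_nnsfun; last exact: measurableC.
rewrite ge0_integralTE //; apply: ereal_sup_ubound => /=.
exists (proj_nnsfun h (measurableC mN)) => [x|]; last first.
  by rewrite (mrestrict h (measurableC mN)).
rewrite /= -[X in X%:E]/(proj_nnsfun h (measurableC mN) x) -mrestrict patchE.
case: ifPn => [/set_mem/fg <-|_]; first exact: hf.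
exact: g0.
Qed.

(** The given coefficients agree with Borel functions only almost everywhere, so replacing them
    under an integral must not require their measurability. *)
Lemma ae_eq_Rintegral D f g :
  {ae mu, forall t, D t -> f t = g t} ->
  (\int[mu]_(t in D) f t = \int[mu]_(t in D) g t)%R.
Proof.
move=> [N [mN N0 subN]]; rewrite /Rintegral; congr fine.
rewrite integral_mkcond [RHS]integral_mkcond.
set F := (fun x => (f x)%:E) \_ D; set G := (fun x => (g x)%:E) \_ D.
have FG x : ~ N x -> F x = G x.
  move=> Nx; rewrite /F /G !patchE; case: ifPn => // /set_mem Dx.
  congr EFin; apply: contrapT => fgx; apply/Nx/subN => /= H; exact/fgx/H.
rewrite integralE [RHS]integralE; congr (_ - _); apply/eqP; rewrite eq_le;
  apply/andP; split; apply: (@ge0_le_integral_off_null _ _ N) => // x Nx;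
  by rewrite ?funeposE ?funenegE FG.
Qed.

End IntegralAe.

#[local] Instance lebesgue_ae_filter (R : realType) :
  Filter (nbhs (almost_everywhere (@lebesgue_measure R))).
Proof. exact: ae_filter_ringOfSetsType. Qed.

Section BoundedMeasurable.
Context {R : realType}.
Local Notation mu := (@lebesgue_measure R).
Implicit Types (a b c d : R) (f g : R -> R) (p : {poly R}).

(** The bound holds at every point rather than essentially, so that it passes to products and can
    serve in pointwise estimates. *)
Definition bounded_measurable a b f : Prop :=
  measurable_fun `[a, b] f /\
  exists C : R, forall t, a <= t <= b -> `|f t| <= C.

Lemma bounded_measurableD a b f g : bounded_measurable a b f ->
  bounded_measurable a b g -> bounded_measurable a b (fun t => f t + g t).
Proof.
move=> [mf [C fC]] [mg [D gD]]; split; first exact: measurable_funD.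
exists (C + D) => t tab; rewrite (le_trans (ler_normD _ _)) //.
by rewrite lerD ?fC ?gD.
Qed.

Lemma bounded_measurableM a b f g : bounded_measurable a b f ->
  bounded_measurable a b g -> bounded_measurable a b (fun t => f t * g t).
Proof.
move=> [mf [C fC]] [mg [D gD]]; split; first exact: measurable_funM.
by exists (C * D) => t tab; rewrite normrM ler_pM ?fC ?gD.
Qed.

Lemma bounded_measurable_continuous a b f : a <= b -> continuous f ->
  bounded_measurable a b f.
Proof.
move=> ab cf; split.
  by apply: measurable_funTS; exact: continuous_measurable_fun.
have [|c _ cmax] := @EVT_max R (fun t => `|f t|) a b ab.
  apply: continuous_subspaceT => t.
  by apply: continuous_comp; [exact: cf | exact: norm_continuous].
by exists `|f c| => t tab; apply: cmax; rewrite in_itv.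
Qed.

Lemma bounded_measurable_horner a b p : a <= b ->
  bounded_measurable a b (horner p).
Proof.
by move=> ab; apply: bounded_measurable_continuous => //; exact: continuous_horner.
Qed.

Lemma bounded_measurable_cst a b (k : R) : bounded_measurable a b (cst k).
Proof. by split; [exact: measurable_cst | exists `|k|]. Qed.

Lemma bounded_measurable_gt a b y :
  bounded_measurable a b (fun t => (y < t)%R%:R).
Proof.
split; last by exists 1 => t _; case: (y < t); rewrite ?normr1 ?normr0.
suff -> : (fun t => (y < t)%R%:R) = \1_(`]y, +oo[) :> (R -> R).
  exact: measurable_indic.
by apply/funext => t; rewrite indicE; congr (_ %:R); rewrite mem_setE in_itv /= andbT.
Qed.

Lemma bounded_measurable_sum a b n (F : nat -> R -> R) :
  (forall k, bounded_measurable a b (F k)) ->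
  bounded_measurable a b (fun t => \sum_(k < n) F k t).
Proof.
move=> bF; elim: n => [|n IHn].
  by under eq_fun do rewrite big_ord0; exact: bounded_measurable_cst.
by under eq_fun do rewrite big_ord_recr; exact: bounded_measurableD.
Qed.

Lemma bounded_measurable_integrable a b f (D : set R) :
  bounded_measurable a b f -> measurable D -> D `<=` `[a, b] ->
  mu.-integrable D (EFin \o f).
Proof.
move=> [mf [C fC]] mD Dab.
suff: mu.-integrable `[a, b] (EFin \o f) by apply: integrableS.
apply: measurable_bounded_integrable => //.
  by rewrite /= lebesgue_measure_itv /=; case: ifP => // _; rewrite -EFinB ltry.
exists C; split; first exact: num_real.
by move=> y Cy t /=; rewrite in_itv /= => tab; rewrite (le_trans (fC t tab)) // ltW.
Qed.

(** Truncation at an essential bound [M] changes the function only on a null set and makes the bound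
    hold everywhere. *)
Lemma Linfty_representative a b f : Linfty a b f ->
  exists2 g, bounded_measurable a b g &
    {ae mu, forall t, t \in `[a, b] -> f t = g t}.
Proof.
move=> [g0 gL fg]; set g := g0 \_ `[a, b] in gL.
have mg : measurable_fun setT g.
  by have := sub_Lfun_mfun gL; rewrite inE.
have [M M0 gM] : exists2 M : R, 0 <= M & {ae mu, forall t, `|g t| <= M}.
  have := sub_Lfun_finLfun gL; rewrite inE /= /finite_norm unlock.
  (* The norm of exponent [+oo] is an essential supremum only on a space of positive measure. *)
  have -> : (0 < mu [set: R])%E.
    apply: (@lt_le_trans _ _ (mu `[0%R, 1%R])).
      by rewrite lebesgue_measure_itv /= lte01 oppr0 adde0.
    by apply: le_measure; rewrite ?inE.
  move=> supg.
  have [M supM] : exists M : R, (ess_sup mu (abse \o (EFin \o g)) <= M%:E)%E.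
    case: (ess_sup _ _) supg => [M _| |] //; first by exists M.
    by exists 0; rewrite leNye.
  exists (Num.max 0 M); first by rewrite le_max lexx.
  have /ess_supP := supM; apply: filterS => t /=.
  by rewrite lee_fin le_max => ->; rewrite orbT.
exists (fun t => Num.max (- M) (Num.min (g t) M)).
  split.
    apply: measurable_funTS; apply: measurable_maxr => //.
    by apply: measurable_minr.
  by exists M => t _; rewrite ler_norml le_max lexx ge_max ge_min lexx orbT andbT; lra.
apply: filterS2 fg gM => t fg gM tab.
rewrite fg // min_l; last by rewrite (le_trans (ler_norm _)).
rewrite max_r; first by rewrite /g patchE mem_set.
by move: gM; rewrite ler_norml => /andP[].
Qed.

Lemma Rintegral_horner p c d : c <= d ->
  \int[mu]_(t in `[c, d]) p.[t] = pint p c d.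
Proof.
rewrite le_eqVlt => /predU1P[->|cd].
  by rewrite set_itv1 Rintegral_set1 /pint subrr.
rewrite /Rintegral (@continuous_FTC2 _ _ (horner (prim p))) //.
- by apply: continuous_subspaceT => t; exact: continuous_horner.
- split=> [t _||]; first exact: derivable_horner.
  + by apply: cvg_at_right_filter; exact: continuous_horner.
  + by apply: cvg_at_left_filter; exact: continuous_horner.
- by move=> t _; rewrite -derivE deriv_prim.
Qed.

Lemma Rintegral_itv_cat a b f c e d : bounded_measurable a b f ->
  a <= c -> c <= e -> e <= d -> d <= b ->
  \int[mu]_(t in `[c, d]) f t =
  \int[mu]_(t in `[c, e]) f t + \int[mu]_(t in `[e, d]) f t.
Proof.
move=> bf ac ce ed db.
have sub u v : c <= u -> v <= d -> `[u, v] `<=` `[a, b].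
  by move=> cu vd t /=; rewrite !in_itv /=; lra.
have -> : \int[mu]_(t in `[e, d]) f t = \int[mu]_(t in `]e, d]) f t.
  rewrite Rintegral_itv_obnd_cbnd //.
  apply: bounded_measurable_integrable bf _ _ => //.
  by move=> t /=; rewrite !in_itv /=; lra.
rewrite -(@Rintegral_itvB _ f (BLeft c) (BRight d) e) ?bnd_simp //; first by ring.
by apply: bounded_measurable_integrable bf _ _ => //; exact: sub.
Qed.

Lemma Rintegral_oo_cc a b f : bounded_measurable a b f ->
  \int[mu]_(t in `]a, b[) f t = \int[mu]_(t in `[a, b]) f t.
Proof.
move=> bf; rewrite Rintegral_itv_bndo_bndc ?Rintegral_itv_obnd_cbnd //.
all: apply: bounded_measurable_integrable bf _ _ => //.
all: by move=> t /=; rewrite !in_itv /= => /andP[? ?]; apply/andP; split; lra.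
Qed.

End BoundedMeasurable.

(** * Testing against smoothed piecewise polynomials *)

Section WeakCoercivity.
Context {R : realType}.
Local Notation mu := (@lebesgue_measure R).
Implicit Types (a b c d t eps : R) (f g phi : R -> R) (p q : {poly R}).

(** The test function vanishes outside a compact subset of the open interval, on which [f] is
    integrable and dominates the product up to a constant. *)
Lemma locally_integrable_mul_test a b f phi : a <= b ->
  locally_integrable `]a, b[ f -> test_function a b phi -> continuous phi ->
  mu.-integrable `]a, b[ (EFin \o (fun t => f t * phi t)).
Proof.
move=> ab [mf _ intf] [_ cK Kab] cphi; set K := closure _ in cK Kab.
have mK : measurable K by exact: compact_measurable.
have [_ [C phiC]] := bounded_measurable_continuous a b phi ab cphi.
have mphi D : measurable_fun D phi.
  by apply: measurable_funTS; exact: continuous_measurable_fun.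
have C0 : 0 <= C.
  by apply: le_trans (phiC a _); rewrite ?lexx ?ab.
have phi0 t : ~ K t -> phi t = 0.
  move=> Kt; apply: contrapT => phit; apply: Kt; apply: subset_closure => /=.
  exact/eqP.
have mfK : measurable_fun K f := measurable_funS (measurable_itv _) Kab mf.
have intK : mu.-integrable K (EFin \o (fun t => f t * phi t)).
  have intf' : mu.-integrable K (EFin \o f).
    by apply/integrableP; split; [exact/measurable_EFinP | exact: intf].
  have intCf : mu.-integrable K (fun t => C%:E * (f t)%:E)%E by exact: integrableZl.
  have mfphi : measurable_fun K (fun t => f t * phi t) := measurable_funM mfK (mphi K).
  apply: le_integrable intCf => //.
    exact/measurable_EFinP.
  move=> t Kt /=; rewrite lee_fin mulrC !normrM ler_wpM2r //.
  rewrite (ger0_norm C0) phiC //.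
  by have := Kab _ Kt; rewrite /= in_itv /= => /andP[? ?]; rewrite !ltW.
pose h := EFin \o (fun t => f t * phi t).
have cond_ab := @integrable_mkcond _ _ R mu [set` `]a, b[] h (measurable_itv _).
have cond_K := @integrable_mkcond _ _ R mu K h mK.
apply/cond_ab; suff -> : h \_ [set` `]a, b[] = h \_ K by exact/cond_K.
apply/funext => t; rewrite !patchE /=.
have [Kt|Kt] := pselect (K t); first by rewrite !mem_set //; exact: Kab.
by rewrite (memNset Kt); case: ifPn => // _; rewrite /h /= phi0 ?mulr0.
Qed.

(** The weak derivative turns the first term into minus the integral of [beta' * phi], and
    [2 * (gamma - kappa) - beta'] is nonnegative almost everywhere. The conclusion is free of
    [beta'], so that limits in [phi] become possible. *)
Lemma weak_derivative_ge0 a b (beta beta' gamma B G : R -> R) kappa phi :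
  a <= b -> weak_derivative a b beta beta' ->
  bounded_measurable a b B -> bounded_measurable a b G ->
  {ae mu, forall t, t \in `[a, b] -> beta t = B t} ->
  {ae mu, forall t, t \in `[a, b] -> gamma t = G t} ->
  {ae mu, forall t, t \in `]a, b[ -> kappa <= gamma t - 2^-1 * beta' t} ->
  test_function a b phi -> continuous phi -> continuous (derive1 phi) ->
  (forall t, 0 <= phi t) ->
  0 <= \int[mu]_(t in `]a, b[)
    (B t * derive1 phi t + 2 * (G t - kappa) * phi t).
Proof.
move=> ab [lib' wd] bB bG betaB gammaG kap tphi cphi cphi' phi0.
have bphi := bounded_measurable_continuous a b _ ab cphi.
have bphi' := bounded_measurable_continuous a b _ ab cphi'.
have sub : [set` `]a, b[] `<=` [set` `[a, b]] by exact: subset_itv_oo_cc.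
have bBphi := bounded_measurableM a b _ _ bB bphi'.
have bGphi : bounded_measurable a b (fun t => 2 * (G t - kappa) * phi t).
  apply: bounded_measurableM => //; apply: bounded_measurableM.
    exact: (bounded_measurable_cst a b 2).
  by apply: bounded_measurableD => //; exact: (bounded_measurable_cst a b (- kappa)).
have iBphi := bounded_measurable_integrable a b _ _ bBphi (measurable_itv `]a, b[) sub.
have iGphi := bounded_measurable_integrable a b _ _ bGphi (measurable_itv `]a, b[) sub.
have ib'phi := locally_integrable_mul_test a b _ _ ab lib' tphi cphi.
rewrite RintegralD //.
have -> : \int[mu]_(t in `]a, b[) (B t * derive1 phi t) =
    \int[mu]_(t in `]a, b[) (beta t * derive1 phi t).
  apply: ae_eq_Rintegral; apply: filterS betaB => t betaB /sub tab.
  by rewrite betaB.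
rewrite wd // addrC -RintegralB //.
(* The integrand is nonnegative only almost everywhere; its absolute value is so at every point. *)
have -> : \int[mu]_(t in `]a, b[) (2 * (G t - kappa) * phi t - beta' t * phi t) =
    \int[mu]_(t in `]a, b[) `|2 * (G t - kappa) * phi t - beta' t * phi t|.
  apply: ae_eq_Rintegral; apply: filterS2 gammaG kap => t gammaG kap tab.
  rewrite ger0_norm // -mulrBl mulr_ge0 // -gammaG; last exact: sub.
  by have := kap tab; lra.
exact: Rintegral_ge0.
Qed.

Lemma horner_bound a b p : a <= b ->
  exists C : R, 0 <= C /\ forall t, a <= t <= b -> `|p.[t]| <= C.
Proof.
move=> ab; have [_ [C pC]] := bounded_measurable_horner a b p ab.
by exists C; split=> //; apply: le_trans (pC a _); rewrite ?lexx ?ab.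
Qed.

(** The derivative of the step costs a factor [1/eps] but lives within [3 * eps] of [y], where the
    zero of [p] makes [p] at most a multiple of [eps]. Hence a bound uniform in [eps] and in the
    displaced node [s]. *)
Lemma smoothed_term_bound a b (y : R) p (step' : R -> R) (C : R) :
  a <= y <= b -> p.[y] = 0 -> (forall t, `|step' t| <= C) ->
  (forall t, t < 0 \/ 1 < t -> step' t = 0) ->
  exists K : R, forall eps (s : R), 0 < eps -> `|s - y| <= 2 * eps ->
    forall t, a <= t <= b ->
      `|p.[t] * step ((t - s) / eps)| <= K /\
      `|p^`().[t] * step ((t - s) / eps) + p.[t] * (step' ((t - s) / eps) / eps)|
        <= K.
Proof.
move=> yab py stepC step'0; have ab : a <= b by lra.
have [u pu] := factor_theorem p y (introT rootP py).
have [K0 [K00 pK]] := horner_bound a b p ab.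
have [K1 [K10 p'K]] := horner_bound a b p^`() ab.
have [K2 [K20 uK]] := horner_bound a b u ab.
have C0 : 0 <= C := le_trans (normr_ge0 _) (stepC 0).
have step_le1 t : `|step t| <= 1.
  rewrite ger0_norm; last by rewrite -(step0 (Num.min 0 t)) ?step_homo ?ge_min ?lexx ?orbT.
  by rewrite -(step1 (Num.max 1 t)) ?step_homo ?le_max ?lexx ?orbT.
exists (K0 + K1 + K2 * 3 * C) => eps s eps0 sy t tab.
set st := step _; have st1 : `|st| <= 1 := step_le1 _.
have KC : 0 <= K2 * 3 * C by rewrite !mulr_ge0.
split.
  rewrite normrM; apply: (@le_trans _ _ (K0 * 1)); last by lra.
  by rewrite ler_pM ?pK.
apply: le_trans (ler_normD _ _) _.
have : `|p^`().[t] * st| <= K1 * 1 by rewrite normrM ler_pM ?p'K.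
suff : `|p.[t] * (step' ((t - s) / eps) / eps)| <= K2 * 3 * C by lra.
have [far|near] := boolP (((t - s) / eps < 0) || (1 < (t - s) / eps)).
  rewrite step'0; last exact/orP.
  by rewrite mul0r mulr0 normr0.
move: near; rewrite negb_or -!leNgt ler_pdivlMr // ler_pdivrMr // mul0r mul1r.
move=> /andP[ts0 ts1].
have ty : `|t - y| <= 3 * eps.
  by move: sy; rewrite !ler_norml => /andP[? ?]; apply/andP; split; lra.
rewrite pu hornerM hornerXsubC !normrM normfV (gtr0_norm eps0).
have ty' : `|t - y| * (`|step' ((t - s) / eps)| / eps) <= 3 * C.
  by rewrite mulrA ler_pdivrMr // mulrAC ler_pM.
rewrite -[leLHS]mulrA -[leRHS]mulrA ler_pM ?uK // mulr_ge0 // divr_ge0 //.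
exact: ltW.
Qed.

(** The step rises between [s] and [s + eps], an interval that stays within [3 * eps] of [y]. *)
Lemma smoothed_term_far (y : R) (step' : R -> R) eps (s t : R) :
  (forall t, t < 0 \/ 1 < t -> step' t = 0) ->
  0 < eps -> `|s - y| <= 2 * eps -> 3 * eps < `|t - y| ->
  step ((t - s) / eps) = (y < t)%R%:R /\ step' ((t - s) / eps) = 0.
Proof.
move=> step'0 eps0; rewrite ler_norml => /andP[sy1 sy2].
have [ty|yt] := leP t y.
  rewrite ler0_norm ?subr_le0 // => yt; have ts : (t - s) / eps < 0.
    by rewrite ltr_pdivrMr // mul0r; lra.
  by rewrite step0 ?(ltW ts) // step'0 //; left.
rewrite gtr0_norm ?subr_gt0 // => ty; have ts : 1 < (t - s) / eps.
  by rewrite ltr_pdivlMr // mul1r; lra.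
by rewrite step1 ?(ltW ts) // step'0 //; right.
Qed.

End WeakCoercivity.

(** * Smoothing of piecewise polynomials and passage to the limit *)

Section Smoothing.
Context {R : realType}.
Local Notation mu := (@lebesgue_measure R).
Implicit Types (t eps : R) (P : nat -> {poly R}).

Lemma mesh_le {a b : R} {N} {x : nat -> R} {i j} : is_mesh a b N x ->
  (i <= j <= N)%N -> x i <= x j.
Proof.
move=> [_ _ xS] /andP[]; elim: j => [|j IHj]; first by rewrite leqn0 => /eqP ->.
rewrite leq_eqVlt => /predU1P[-> //|]; rewrite ltnS => ij jN.
by apply: le_trans (IHj ij (ltnW jN)) _; apply/ltW/xS.
Qed.

Lemma mesh_bounds {a b : R} {N} {x : nat -> R} {i} : is_mesh a b N x ->
  (i <= N)%N -> a <= x i <= b.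
Proof.
move=> mx iN; have [<- <- _] := mx.
by rewrite (mesh_le mx) //= (mesh_le mx) // iN leqnn.
Qed.

Lemma ae_not_nodes N (x : nat -> R) :
  {ae mu, forall t, forall k, (k < N.+1)%N -> t != x k}.
Proof.
elim: N.+1 => [|n IHn].
  by apply: (@filterS _ _ _ setT) => //; exact: filterT.
have xn : {ae mu, forall t, t != x n}.
  exists [set x n]; split => //; first exact: lebesgue_measure_set1.
  by move=> t /= /negP; rewrite negbK => /eqP.
apply: filterS2 IHn xn => t tk tn k; rewrite ltnS leq_eqVlt => /predU1P[-> //|].
exact: tk.
Qed.

Lemma abel_sum n (u T : nat -> R) :
  \sum_(k < n.+1) (u k.+1 - u k) * T k =
  u n.+1 * T n - u 0%N * T 0%N + \sum_(k < n) u k.+1 * (T k - T k.+1).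
Proof.
elim: n => [|n IHn]; first by rewrite big_ord_recr !big_ord0 /=; ring.
by rewrite big_ord_recr IHn [in RHS]big_ord_recr /=; ring.
Qed.

(* With [P 0 = 0], the function equal to [P i] on the i-th cell. *)
Definition piecewise N (x : nat -> R) P t : R :=
  \sum_(k < N.+1) (P k.+1 - P k).[t] * (x k < t)%R%:R.

Lemma piecewiseE a b N x P i t : is_mesh a b N x -> P 0%N = 0 ->
  (0 < i <= N)%N -> x i.-1 < t < x i -> piecewise N x P t = (P i).[t].
Proof.
move=> mx P0 /andP[i0 iN] /andP[ti it].
rewrite /piecewise -(big_mkord xpredT (fun k => (P k.+1 - P k).[t] * (x k < t)%R%:R)).
rewrite (big_cat_nat _ (n := i)) //=; last by rewrite ltnW.
rewrite [X in _ + X]big_nat_cond [X in _ + X]big1 ?addr0; last first.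
  move=> k /andP[/andP[ik kN] _]; rewrite ltNge ltW ?mulr0 //.
  by apply: lt_le_trans it _; apply: (mesh_le mx); rewrite ik.
rewrite big_nat_cond (eq_bigr (fun k => (P k.+1).[t] - (P k).[t])); last first.
  move=> k /andP[/andP[_ ki] _]; rewrite hornerD hornerN (le_lt_trans _ ti) ?mulr1 //.
  by apply: (mesh_le mx); case: i i0 iN ki {ti it} => //= i _ iN; rewrite ltnS => ->; rewrite ltnW.
by rewrite -big_nat_cond telescope_sumr // P0 horner0 subr0.
Qed.

Lemma bounded_measurable_piecewise a b N x P : a <= b ->
  bounded_measurable a b (piecewise N x P).
Proof.
move=> ab; apply: (bounded_measurable_sum a b N.+1
  (fun k t => (P k.+1 - P k).[t] * (x k < t)%R%:R)) => k.
apply: bounded_measurableM; first exact: bounded_measurable_horner.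
exact: bounded_measurable_gt.
Qed.

Variables (a b : R) (N : nat) (x : nat -> R) (P : nat -> {poly R}).
Hypotheses (ab : a < b) (mx : is_mesh a b N x).
Hypotheses (P0 : P 0%N = 0) (PN : P N.+1 = 0).
Hypothesis P_cont : forall k, (k <= N)%N -> (P k.+1).[x k] = (P k).[x k].
Hypothesis P_ge0 : forall k t, 0 <= (P k).[t].

(* The nodes are moved inwards so that the smoothed function is supported in
   [a + eps, b - eps]. *)
Let node eps k := x k + eps * (1 - 3 * ((x k - a) / (b - a))).

Let phi eps t := \sum_(k < N.+1) (P k.+1 - P k).[t] * step ((t - node eps k) / eps).

Let ratio_bnd k : (k <= N)%N -> 0 <= (x k - a) / (b - a) <= 1.
Proof.
move=> kN; have := mesh_bounds mx kN => /andP[ax xb].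
by rewrite divr_ge0 ?ler_pdivrMr /= ?subr_ge0 ?subr_gt0 ?(ltW ab) // mul1r lerB.
Qed.

(** The factor of [eps] in the displacement ranges from 1 at [a] to -2 at [b]. *)
Let node_near eps k : 0 < eps -> (k <= N)%N -> `|node eps k - x k| <= 2 * eps.
Proof.
move=> e0 /ratio_bnd; rewrite /node; set y := _ / _ => /andP[y0 y1].
by rewrite ler_norml; apply/andP; split; nra.
Qed.

(** The displaced node is affine in [x k] with slope [1 - 3 * eps / (b - a)], which is nonnegative
    for such [eps]. *)
Let node_homo eps i j : 0 < eps -> 3 * eps <= b - a -> (i <= j <= N)%N ->
  node eps i <= node eps j.
Proof.
move=> e0 e3 ij; have xij := mesh_le mx ij; rewrite /node.
have -> : (x j - a) / (b - a) = (x i - a) / (b - a) + (x j - x i) / (b - a).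
  by rewrite -mulrDl; congr (_ / _); ring.
have H : 3 * eps * ((x j - x i) / (b - a)) <= x j - x i.
  by rewrite mulrA ler_pdivrMr ?subr_gt0 // mulrC ler_wpM2l // subr_ge0.
by nra.
Qed.

(** The outermost displaced nodes are [a + eps] and [b - 2 * eps]; the asymmetry leaves room for the
    rise of the last step, of width [eps]. *)
Let node_bounds eps k : 0 < eps -> 3 * eps <= b - a -> (k <= N)%N ->
  a + eps <= node eps k /\ node eps k + eps <= b - eps.
Proof.
move=> e0 e3 kN; have [x0 xN _] := mx.
have := node_homo _ 0 k e0 e3 kN; have := node_homo _ k N e0 e3.
rewrite kN leqnn /node x0 xN subrr mul0r divff ?subr_eq0 ?gt_eqF // => /(_ isT).
by move=> ? ?; split; lra.
Qed.

(** Summation by parts turns jumps times steps into pieces times differences of steps. Ordered nodes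
    and a monotone step make these differences nonnegative, and the boundary terms vanish with [P 0]
    and [P N.+1]. *)
Let phi_ge0 eps t : 0 < eps -> 3 * eps <= b - a -> 0 <= phi eps t.
Proof.
move=> e0 e3; rewrite /phi.
under eq_bigr do rewrite hornerD hornerN.
rewrite (abel_sum N (fun k => (P k).[t]) (fun k => step ((t - node eps k) / eps))).
rewrite P0 PN !horner0 !mul0r subrr add0r sumr_ge0 // => k _.
rewrite mulr_ge0 // subr_ge0 step_homo // ler_wpM2r ?invr_ge0 ?(ltW e0) //.
by rewrite lerB // node_homo // leqnSn /=.
Qed.

(** Near [a] all steps are 0; near [b] all are 1 and the increments telescope to
    [P N.+1 - P 0 = 0]. *)
Let phi_supp eps t : 0 < eps -> 3 * eps <= b - a ->
  t <= a + eps \/ b - eps <= t -> phi eps t = 0.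
Proof.
move=> e0 e3 [ta|bt].
  rewrite /phi big1 // => k _.
  have [? ?] := node_bounds _ k e0 e3 (ltn_ord k).
  rewrite step0 ?mulr0 //; rewrite ler_pdivrMr // mul0r; lra.
rewrite /phi (eq_bigr (fun k : 'I__ => (P k.+1).[t] - (P k).[t])); last first.
  move=> k _; have [? ?] := node_bounds _ k e0 e3 (ltn_ord k).
  rewrite step1 ?mulr1 ?hornerD ?hornerN //; rewrite ler_pdivlMr // mul1r; lra.
rewrite -(big_mkord xpredT (fun k => (P k.+1).[t] - (P k).[t])) telescope_sumr //.
by rewrite P0 PN horner0 subrr.
Qed.

Let smooth_phi eps : smooth (phi eps).
Proof.
apply: smooth_sum => k; apply: smooth_mul; first exact: smooth_horner.
suff -> : (fun t => step ((t - node eps k) / eps)) =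
    step \o horner (eps^-1 *: ('X - (node eps k)%:P)).
  by apply: smooth_comp; [exact: smooth_step | exact: smooth_horner].
by apply/funext => t /=; rewrite !hornerE mulrC.
Qed.

Let test_phi eps : 0 < eps -> 3 * eps <= b - a -> test_function a b (phi eps).
Proof.
move=> e0 e3; have supp : closure [set t | phi eps t != 0] `<=` `[a + eps, b - eps].
  have -> : [set` `[a + eps, b - eps]] = closure [set` `[a + eps, b - eps]].
    exact/closure_id/itv_closed.
  apply: closure_subset => t /= phit; rewrite in_itv /=.
  apply: contraNT phit; rewrite negb_and -!ltNge => /orP[]/ltW ?;
    rewrite phi_supp //; [by left | by right].
split.
- by move=> n t; exact/smooth_derivable/smooth_phi.
- apply: subclosed_compact supp; first exact: closed_closure.
  exact: segment_compact.
- apply: subset_trans supp _ => t /=; rewrite !in_itv /= => /andP[? ?].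
  by apply/andP; split; lra.
Qed.

Let phi' step' eps t := \sum_(k < N.+1) ((P k.+1 - P k)^`().[t] *
    step ((t - node eps k) / eps) +
    (P k.+1 - P k).[t] * (step' ((t - node eps k) / eps) / eps)).

Let phi_derive step' eps : (forall t : R, is_derive t 1 step (step' t)) ->
  derive1 (phi eps) = phi' step' eps.
Proof.
move=> dstep; apply/funext => t; rewrite derive1E /phi /phi'.
suff : is_derive t 1 (fun t => \sum_(k < N.+1) (P k.+1 - P k).[t] *
    step ((t - node eps k) / eps)) (phi' step' eps t) by case.
rewrite /phi'; elim: N.+1 => [|n IHn].
  under eq_fun do rewrite big_ord0.
  by rewrite big_ord0; exact: is_derive_cst.
under eq_fun do rewrite big_ord_recr /=.
rewrite big_ord_recr /=.
set p := P n.+1 - P n; set s := node eps n.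
have daff : is_derive t 1 (fun t => (t - s) / eps) (eps^-1).
  suff -> : (fun t => (t - s) / eps) = horner (eps^-1 *: ('X - s%:P)).
    have := is_derive_poly (eps^-1 *: ('X - s%:P)) t.
    by rewrite derivZ derivXsubC hornerZ hornerC mulr1.
  by apply/funext => u /=; rewrite hornerZ hornerXsubC mulrC.
have dT := @is_derive1_comp R step (fun t => (t - s) / eps) t _ _ (dstep _) daff.
have dpT := is_deriveM (is_derive_poly p t) dT.
have H : is_derive t 1 (fun t => p.[t] * step ((t - s) / eps))
    (p^`().[t] * step ((t - s) / eps) + p.[t] * (step' ((t - s) / eps) / eps)).
  by apply: is_derive_eq dpT _; rewrite addrC; congr (_ + _); exact: mulrC.
exact: is_deriveD IHn H.
Qed.

Let eps_ n : R := (b - a) / 3 * n.+1%:R^-1.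

Let eps_gt0 n : 0 < eps_ n.
Proof. by rewrite /eps_ mulr_gt0 ?invr_gt0 ?divr_gt0 ?subr_gt0. Qed.

Let eps_le n : 3 * eps_ n <= b - a.
Proof.
rewrite /eps_ mulrA mulrCA divff // mulr1 ler_piMr ?subr_ge0 ?(ltW ab) //.
by rewrite invf_le1 ?ltr0n // ler1n.
Qed.

Let eps_near (e : R) : 0 < e -> \forall n \near \oo, 3 * eps_ n < e.
Proof.
move=> e0; have e0' : 0 < e / (b - a) by rewrite divr_gt0 ?subr_gt0.
near=> n; rewrite /eps_ mulrA mulrCA divff // mulr1 mulrC -ltr_pdivlMr ?subr_gt0 //.
by near: n; exact: (near_infty_natSinv_lt (PosNum e0')).
Unshelve. all: by end_near. Qed.

(** Dominated convergence along [eps_] extends the smooth case; the uniform bounds on the smoothed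
    terms provide a constant dominating function. *)
Lemma weak_derivative_piecewise_ge0 (beta beta' gamma B G : R -> R) kappa :
  weak_derivative a b beta beta' ->
  bounded_measurable a b B -> bounded_measurable a b G ->
  {ae mu, forall t, t \in `[a, b] -> beta t = B t} ->
  {ae mu, forall t, t \in `[a, b] -> gamma t = G t} ->
  {ae mu, forall t, t \in `]a, b[ -> kappa <= gamma t - 2^-1 * beta' t} ->
  0 <= \int[mu]_(t in `[a, b])
    (B t * piecewise N x (fun k => (P k)^`()) t +
     2 * (G t - kappa) * piecewise N x P t).
Proof.
move=> wd bB bG betaB gammaG kap.
have [step' [C [dstep stepC step'0]]] := @step_derive R.
have p_bound (k : 'I_N.+1) : exists K : R, forall eps (s : R),
    0 < eps -> `|s - x k| <= 2 * eps -> forall t, a <= t <= b ->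
      `|(P k.+1 - P k).[t] * step ((t - s) / eps)| <= K /\
      `|(P k.+1 - P k)^`().[t] * step ((t - s) / eps) +
        (P k.+1 - P k).[t] * (step' ((t - s) / eps) / eps)| <= K.
  apply: (smoothed_term_bound a b (x k) _ step' C) => //.
    exact: mesh_bounds mx (ltn_ord k).
  by rewrite hornerD hornerN P_cont ?subrr // -ltnS.
have [K HK] := choice p_bound.
pose M := \sum_(k < N.+1) K k.
have phiM n t : a <= t <= b -> `|phi (eps_ n) t| <= M.
  move=> tab; apply: le_trans (ler_norm_sum _ _ _) _; apply: ler_sum => k _.
  by have [] := HK k _ _ (eps_gt0 n) (node_near _ k (eps_gt0 n) (ltn_ord k)) t tab.
have phi'M n t : a <= t <= b -> `|phi' step' (eps_ n) t| <= M.
  move=> tab; apply: le_trans (ler_norm_sum _ _ _) _; apply: ler_sum => k _.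
  by have [] := HK k _ _ (eps_gt0 n) (node_near _ k (eps_gt0 n) (ltn_ord k)) t tab.
pose F n t := B t * phi' step' (eps_ n) t + 2 * (G t - kappa) * phi (eps_ n) t.
pose F0 t := B t * piecewise N x (fun k => (P k)^`()) t +
  2 * (G t - kappa) * piecewise N x P t.
have bGk : bounded_measurable a b (fun t => 2 * (G t - kappa)).
  apply: bounded_measurableM; first exact: (bounded_measurable_cst a b 2).
  by apply: bounded_measurableD => //; exact: (bounded_measurable_cst a b (- kappa)).
have bF n : bounded_measurable a b (F n).
  apply: bounded_measurableD; apply: bounded_measurableM => //.
    rewrite -phi_derive //; apply: bounded_measurable_continuous; first exact: ltW.
    exact/smooth_continuous/smooth_derive1/smooth_phi.
  apply: bounded_measurable_continuous; first exact: ltW.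
  exact/smooth_continuous/smooth_phi.
have bF0 : bounded_measurable a b F0.
  apply: bounded_measurableD; apply: bounded_measurableM => //;
    exact/bounded_measurable_piecewise/ltW.
have sub : [set` `]a, b[] `<=` [set` `[a, b]] by exact: subset_itv_oo_cc.
have F_ge0 n : 0 <= \int[mu]_(t in `]a, b[) F n t.
  have := weak_derivative_ge0 a b beta beta' gamma B G kappa (phi (eps_ n)) (ltW ab) wd
    bB bG betaB gammaG kap (test_phi _ (eps_gt0 n) (eps_le n)).
  rewrite phi_derive //; apply.
  - exact/smooth_continuous/smooth_phi.
  - by rewrite -phi_derive //; exact/smooth_continuous/smooth_derive1/smooth_phi.
  - by move=> t; exact: phi_ge0.
have [_ [CB BC]] := bB; have [_ [CG GC]] := bGk.
pose m := CB * M + CG * M.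
rewrite -/F0 -(Rintegral_oo_cc _ _ _ bF0).
pose F_ n t := (F n t)%:E; pose F0_ t := (F0 t)%:E.
have iF n := bounded_measurable_integrable a b _ _ (bF n) (measurable_itv `]a, b[) sub.
have iF0 := bounded_measurable_integrable a b _ _ bF0 (measurable_itv `]a, b[) sub.
have M_int := bounded_measurable_integrable a b _ _
  (bounded_measurable_cst a b m) (measurable_itv `]a, b[) sub.
(* Off the nodes the integrands are eventually constant in [n], since [3 * eps_ n] drops below the
   distance to every node. *)
have F_cvg : {ae mu, forall t, [set` `]a, b[] t -> F_ n t @[n --> \oo] --> F0_ t}.
  apply: filterS (ae_not_nodes N x) => t tx _; apply: cvg_near_cst.
  have : \forall n \near \oo, forall k : 'I_N.+1, 3 * eps_ n < `|t - x k|.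
    apply: filter_forall => k; apply: eps_near.
    by rewrite normr_gt0 subr_eq0 tx.
  apply: filterS => n far; rewrite /F_ /F0_ /F /F0; congr (_ * _ + _ * _)%:E.
    apply: eq_bigr => k _.
    have [-> ->] := smoothed_term_far (x k) step' _ _ _ step'0 (eps_gt0 n)
      (node_near _ k (eps_gt0 n) (ltn_ord k)) (far k).
    by rewrite mul0r mulr0 addr0 derivB.
  apply: eq_bigr => k _.
  by have [-> _] := smoothed_term_far (x k) step' _ _ _ step'0 (eps_gt0 n)
    (node_near _ k (eps_gt0 n) (ltn_ord k)) (far k).
have F_dom : {ae mu, forall t, forall n, [set` `]a, b[] t ->
    (`|F_ n t| <= (EFin \o cst m) t)%E}.
  apply: aeW => t n /sub; rewrite /= in_itv /= => tab.
  rewrite lee_fin (le_trans (ler_normD _ _)) // !normrM.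
  by rewrite lerD // ler_pM ?BC ?phiM ?phi'M // -normrM GC.
have dc := @dominated_convergence _ _ R mu [set` `]a, b[] (measurable_itv _) F_ F0_
  (EFin \o cst m) (fun n => measurable_int _ (iF n)) (measurable_int _ iF0).
have [_ _ cv] := dc F_cvg M_int F_dom.
rewrite fine_ge0 //.
rewrite -(cvg_lim _ cv) //; apply: lime_ge; first by apply/cvg_ex; eexists; exact: cv.
apply: nearW => n /=; have := F_ge0 n; rewrite /Rintegral.
have fin : (\int[mu]_(t in `]a, b[) F_ n t)%E \is a fin_num.
  by apply: integrable_fin_num => //; exact: iF.
by rewrite -lee_fin fineK.
Qed.

End Smoothing.

(** * One cell *)

Section Cell.
Context {R : realType}.
Implicit Types (p Q : {poly R}) (t : R).

(** [S * (S * U - T ^+ 2)] is a weighted sum of squares, which settles the case [S > 0]; if [S = 0],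
    all weights in the sum vanish. *)
Lemma weighted_cauchy_schwarz (s : seq nat) (w y : nat -> R) :
  (forall i, 0 <= w i) ->
  (\sum_(i <- s) w i * y i) ^+ 2 <=
  (\sum_(i <- s) w i) * \sum_(i <- s) w i * y i ^+ 2.
Proof.
move=> w0; set S := \sum_(i <- s) w i; set T := \sum_(i <- s) w i * y i.
set U := \sum_(i <- s) _.
have S0 : 0 <= S by apply: sumr_ge0.
have H : 0 <= S * (S * U - T ^+ 2).
  have -> : S * (S * U - T ^+ 2) = \sum_(i <- s) w i * (S * y i - T) ^+ 2.
    rewrite (eq_bigr (fun i => S ^+ 2 * (w i * y i ^+ 2) + - (2 * S * T) * (w i * y i)
      + T ^+ 2 * w i)); last by move=> i _; ring.
    by rewrite !big_split /= -!mulr_sumr -/S -/T -/U; ring.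
  by apply: sumr_ge0 => i _; rewrite mulr_ge0 ?sqr_ge0.
have [S1|S1] := ltP 0 S; first by move: H; rewrite pmulr_rge0 // subr_ge0.
have /eqP : S = 0 by lra.
rewrite psumr_eq0 // => /allP /= ws.
have -> : T = 0 by rewrite /T big1_seq // => i /= /ws /eqP ->; rewrite mul0r.
by rewrite expr0n /= mulr_ge0 // sumr_ge0 // => i _; rewrite mulr_ge0 ?sqr_ge0.
Qed.

Variables (r : nat) (A : nat -> R).
Hypotheses (r_gt0 : (0 < r)%N) (A_ge0 : forall j, 0 <= A j).
Hypothesis A_exact : forall Q, (size Q <= r.*2.+1)%N ->
  \sum_(1 <= j < r.+1) A j * Q^`().[@gauss_ref R r j] = Q.[1] - Q.[-1].

(** Arbitrary end points serve because the quadrature is also applied on subintervals; on a cell the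
    expression is convertible with [gauss_in_cell]. *)
Definition cell_node (c d : R) j : R := 2^-1 * (d + c + (d - c) * gauss_ref r j).
Definition cell_weight (c d : R) j : R := (d - c) / 2 * A j.

Lemma cell_quadrature c d Q : (size Q <= r.*2.+1)%N ->
  \sum_(1 <= j < r.+1) cell_weight c d j * Q^`().[cell_node c d j] = Q.[d] - Q.[c].
Proof.
move=> sQ; pose L : {poly R} := ((d - c) / 2) *: 'X + ((d + c) / 2)%:P.
have LE t : L.[t] = (d - c) / 2 * t + (d + c) / 2.
  by rewrite hornerD hornerZ hornerX hornerC.
have L' : L^`() = ((d - c) / 2)%:P by rewrite derivD derivZ derivX derivC addr0 alg_polyC.
have sQL : (size (Q \Po L) <= r.*2.+1)%N.
  have sL : ((size L).-1 <= 1)%N.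
    have : (size L <= 2)%N.
      rewrite (leq_trans (size_polyD _ _)) // geq_max (leq_trans (size_polyC_leq1 _)) //.
      by rewrite (leq_trans (size_scale_leq _ _)) // size_polyX.
    by case: (size L).
  rewrite (leq_trans (size_comp_poly_leq _ _)) // ltnS.
  apply: (@leq_trans ((size Q).-1 * 1)); first by rewrite leq_mul2l sL orbT.
  by rewrite muln1; case: (size Q) sQ.
have := A_exact _ sQL; rewrite !horner_comp !LE.
have -> : (d - c) / 2 * 1 + (d + c) / 2 = d by field.
have -> : (d - c) / 2 * -1 + (d + c) / 2 = c by field.
move=> <-; apply: eq_bigr => j _.
rewrite deriv_comp hornerM horner_comp L' hornerC LE /cell_weight /cell_node.
have -> : 2^-1 * (d + c + (d - c) * gauss_ref r j) =
  (d - c) / 2 * gauss_ref r j + (d + c) / 2 by ring.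
by ring.
Qed.

Lemma size_deriv_sq p : (size p <= r.+1)%N -> (size (prim (p^`() ^+ 2)) <= r.*2.+1)%N.
Proof.
move=> sp; rewrite (leq_trans (size_prim _)) // ltnS expr2.
have s' : (size p^`() <= r)%N by rewrite size_deriv; case: (size p) sp.
by rewrite (leq_trans (size_mul_leq _ _)) // (leq_trans (leq_pred _)) // -addnn leq_add.
Qed.

Lemma cell_weight_ge0 c d j : c <= d -> 0 <= cell_weight c d j.
Proof. by move=> cd; rewrite mulr_ge0 // divr_ge0 // subr_ge0. Qed.

Lemma sum_cell_weight c d : \sum_(1 <= j < r.+1) cell_weight c d j = d - c.
Proof.
have := cell_quadrature c d 'X; rewrite !hornerX => <-.
  by apply: eq_bigr => j _; rewrite derivX hornerC mulr1.
by rewrite size_polyX; move: r_gt0; rewrite -double_gt0; case: (r.*2).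
Qed.

Lemma sum_deriv_sq c d p : (size p <= r.+1)%N ->
  \sum_(1 <= j < r.+1) cell_weight c d j * p^`().[cell_node c d j] ^+ 2 =
  pint (p^`() ^+ 2) c d.
Proof.
move=> sp; rewrite /pint -cell_quadrature; last exact: size_deriv_sq.
by apply: eq_bigr => j _; rewrite deriv_prim horner_exp.
Qed.

(** A discrete antiderivative of the derivative of [p]; exactness of the quadrature makes it reach
    [p.[d]] at [j = r]. *)
Definition cell_coef c d p j : R :=
  p.[c] + \sum_(1 <= k < j.+1) cell_weight c d k * p^`().[cell_node c d k].

Lemma size_le_quadrature p : (size p <= r.+1)%N -> (size p <= r.*2.+1)%N.
Proof. by move=> sp; rewrite (leq_trans sp) // ltnS -addnn leq_addr. Qed.

Lemma cell_coef_last c d p : (size p <= r.+1)%N -> cell_coef c d p r = p.[d].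
Proof.
by move=> sp; rewrite /cell_coef cell_quadrature ?size_le_quadrature // addrC subrK.
Qed.

Lemma partial_sum_le j (F : nat -> R) : (j <= r)%N -> (forall k, 0 <= F k) ->
  \sum_(1 <= k < j.+1) F k <= \sum_(1 <= k < r.+1) F k.
Proof.
move=> jr F0; rewrite [leRHS](big_cat_nat _ (n := j.+1)) //= lerDl.
by rewrite sumr_ge0.
Qed.

(** Both values differ from [p.[c]] by a weighted sum of derivative values, bounded by
    Cauchy-Schwarz with total weight at most [d - c]. Combining the two squared bounds gives the
    factor 4. *)
Lemma cell_coef_dist c d p j t : (size p <= r.+1)%N -> (j <= r)%N -> c <= t <= d ->
  (cell_coef c d p j - p.[t]) ^+ 2 <= 4 * (d - c) * pint (p^`() ^+ 2) c d.
Proof.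
move=> sp jr /andP[ct td]; have cd : c <= d := le_trans ct td.
set D := pint _ _ _.
have sq_ge0 s u : s <= u -> 0 <= pint (p^`() ^+ 2) s u.
  by move=> su; apply: pint_ge0 => // v _; rewrite horner_exp sqr_ge0.
(* The quadrature on [[c, t]] expresses this increment, so that the discrete Cauchy-Schwarz
   inequality replaces the integral one. *)
have H1 : (p.[t] - p.[c]) ^+ 2 <= (d - c) * D.
  apply: (@le_trans _ _ ((t - c) * pint (p^`() ^+ 2) c t)).
    rewrite -sum_deriv_sq // -sum_cell_weight -(cell_quadrature _ _ p) ?size_le_quadrature //.
    by apply: weighted_cauchy_schwarz => i; exact: cell_weight_ge0.
  apply: ler_pM; [by rewrite subr_ge0 | exact: sq_ge0 | exact: lerB |].
  by rewrite /D -(pint_cat _ c t d) lerDl sq_ge0.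
have H2 : (cell_coef c d p j - p.[c]) ^+ 2 <= (d - c) * D.
  rewrite /cell_coef addrC addKr.
  have := weighted_cauchy_schwarz (index_iota 1 j.+1) _
    (fun k => p^`().[cell_node c d k]) (fun i => cell_weight_ge0 c d i cd).
  move=> /le_trans; apply; rewrite ler_pM //.
  - by apply: sumr_ge0 => k _; exact: cell_weight_ge0.
  - by apply: sumr_ge0 => k _; rewrite mulr_ge0 ?sqr_ge0 ?cell_weight_ge0.
  - rewrite -sum_cell_weight; apply: partial_sum_le => // k; exact: cell_weight_ge0.
  - rewrite /D -sum_deriv_sq //; apply: partial_sum_le => // k.
    by rewrite mulr_ge0 ?sqr_ge0 ?cell_weight_ge0.
set y1 := cell_coef _ _ _ _ in H2 *; set y2 := p.[t] in H1 *; set y3 := p.[c] in H1 H2.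
have : (y1 - y2) ^+ 2 <= 2 * (y1 - y3) ^+ 2 + 2 * (y2 - y3) ^+ 2.
  rewrite -subr_ge0.
  have -> : 2 * (y1 - y3) ^+ 2 + 2 * (y2 - y3) ^+ 2 - (y1 - y2) ^+ 2 =
    (y1 + y2 - 2 * y3) ^+ 2 by ring.
  exact: sqr_ge0.
by lra.
Qed.

(** The inequality [W^2 <= 2 p(t)^2 + 2 (W - p(t))^2] is integrated over the cell after bounding its
    last square by [cell_coef_dist]. *)
Lemma cell_coef_sq c d p j : (size p <= r.+1)%N -> (j <= r)%N -> c <= d ->
  (d - c) * cell_coef c d p j ^+ 2 <=
  2 * pint (p ^+ 2) c d + 8 * (d - c) ^+ 2 * pint (p^`() ^+ 2) c d.
Proof.
move=> sp jr cd; set W := cell_coef _ _ _ _; set D := pint (p^`() ^+ 2) c d.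
have : 0 <= pint (2 *: p ^+ 2 + (8 * (d - c) * D - W ^+ 2)%:P) c d.
  apply: pint_ge0 => // t /andP[ct td].
  have := cell_coef_dist c d p j t sp jr; rewrite (ltW ct) (ltW td) => /(_ isT).
  rewrite -/W -/D hornerD hornerZ horner_exp hornerC; set y := p.[t].
  have : 0 <= (W - 2 * y) ^+ 2 by exact: sqr_ge0.
  by rewrite !expr2; lra.
by rewrite pintD pintZ pintC; lra.
Qed.

Lemma cell_node_bnd c d j : c < d -> (0 < j <= r)%N -> c < cell_node c d j < d.
Proof.
move=> cd /gauss_ref_bnd => /(_ R)/andP[g1 g2]; rewrite /cell_node.
by apply/andP; split; nra.
Qed.

Lemma cell_node_lt c d j : c < d -> (0 < j < r)%N ->
  cell_node c d j < cell_node c d j.+1.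
Proof.
move=> cd /gauss_ref_lt => /(_ R) g; rewrite /cell_node ltr_pM2l ?invr_gt0 //.
by rewrite ltrD2l ltr_pM2l // subr_gt0.
Qed.

End Cell.

Section Piece.
Context {R : realType}.
Local Notation mu := (@lebesgue_measure R).

(* Young's inequality with weight [h], applied to the product [(w - p) * F]. *)
Lemma piece_lower_bound (a b c d : R) (p : {poly R}) (B G F H : R -> R)
    (M h D w kappa : R) :
  0 < h -> a <= c -> c <= d -> d <= b ->
  bounded_measurable a b F -> bounded_measurable a b H ->
  (forall t, a <= t <= b -> `|B t| <= M) -> (forall t, a <= t <= b -> `|G t| <= M) ->
  (forall t, c < t < d -> F t = B t * p^`().[t] + G t * p.[t]) ->
  (forall t, c < t < d -> H t = B t * (p ^+ 2)^`().[t] + 2 * (G t - kappa) * (p ^+ 2).[t]) ->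
  (forall t, c < t < d -> (w - p.[t]) ^+ 2 <= 4 * h * D) ->
  2^-1 * (\int[mu]_(t in `[c, d]) H t) + kappa * pint (p ^+ 2) c d
    - 2 * D * (d - c) - h * M ^+ 2 * pint (p^`() ^+ 2 + p ^+ 2) c d <=
  w * \int[mu]_(t in `[c, d]) F t.
Proof.
move=> h0 ac cd db bF bH BM GM FE HE wp.
have sub : [set` `[c, d]] `<=` [set` `[a, b]].
  by move=> t /=; rewrite !in_itv /= => /andP[? ?]; apply/andP; split; lra.
have ab : a <= b by lra.
have restr f : bounded_measurable a b f -> bounded_measurable c d f.
  move=> [mf [C fC]]; split; first exact: measurable_funS mf.
  by exists C => t /andP[? ?]; apply: fC; apply/andP; split; lra.
have bF' := restr _ bF; have bH' := restr _ bH.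
(* Inside the interval [p * F] equals [H / 2 + kappa * p^2], so the claim reduces to the pointwise
   bound [H / 2 + q <= w * F], with [q] gathering all polynomial terms. *)
pose q : {poly R} := kappa *: p ^+ 2 - (2 * D)%:P - (h * M ^+ 2) *: (p^`() ^+ 2 + p ^+ 2).
have bq := bounded_measurable_horner c d q cd.
have cst k := bounded_measurable_cst c d k.
have bH2 := bounded_measurableM _ _ _ _ (cst 2^-1) bH'.
have bwF := bounded_measurableM _ _ _ _ (cst w) bF'.
have int f (bf : bounded_measurable c d f) := bounded_measurable_integrable c d _ _
  bf (measurable_itv `[c, d]) (@subset_refl _ _).
have -> : 2^-1 * (\int[mu]_(t in `[c, d]) H t) + kappa * pint (p ^+ 2) c d
    - 2 * D * (d - c) - h * M ^+ 2 * pint (p^`() ^+ 2 + p ^+ 2) c d =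
    \int[mu]_(t in `[c, d]) (2^-1 * H t + q.[t]).
  rewrite RintegralD ?RintegralZl ?Rintegral_horner //; try exact: int.
  rewrite /q !(pintD, pintN, pintZ, pintC); ring.
rewrite -RintegralZl //; last exact: int.
rewrite -(Rintegral_oo_cc _ _ _ bwF) -Rintegral_oo_cc; last exact: bounded_measurableD.
have subo : [set` `]c, d[] `<=` [set` `[c, d]] by exact: subset_itv_oo_cc.
apply: le_Rintegral => //.
- exact: (bounded_measurable_integrable c d _ _ (bounded_measurableD _ _ _ _ bH2 bq)).
- exact: (bounded_measurable_integrable c d _ _ bwF).
move=> t; rewrite /= in_itv /= => tcd.
have tab : a <= t <= b by move: tcd => /andP[? ?]; apply/andP; split; lra.
have Fb : F t ^+ 2 <= 2 * M ^+ 2 * (p^`().[t] ^+ 2 + p.[t] ^+ 2).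
  have sqM (z : R) : `|z| <= M -> z ^+ 2 <= M ^+ 2.
    by move=> zM; rewrite -(real_normK (num_real z)) lerXn2r // nnegrE (le_trans _ zM).
  have B2 := sqM _ (BM t tab); have G2 := sqM _ (GM t tab).
  rewrite FE //; set y := p^`().[t]; set z := p.[t]; set B0 := B t; set G0 := G t.
  have -> : 2 * M ^+ 2 * (y ^+ 2 + z ^+ 2) = (B0 * y + G0 * z) ^+ 2
    + (B0 * y - G0 * z) ^+ 2 + 2 * ((M ^+ 2 - B0 ^+ 2) * y ^+ 2)
    + 2 * ((M ^+ 2 - G0 ^+ 2) * z ^+ 2) by ring.
  rewrite -!addrA lerDl !addr_ge0 ?sqr_ge0 // mulr_ge0 // mulr_ge0 ?sqr_ge0 //.
    by rewrite subr_ge0.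
  by rewrite subr_ge0.
have young : - (2 * D) - h * M ^+ 2 * (p^`().[t] ^+ 2 + p.[t] ^+ 2) <= (w - p.[t]) * F t.
  have := wp _ tcd; set z := w - p.[t]; set f := F t in Fb * => z2.
  have Y : 0 <= z ^+ 2 + 2 * h * (z * f) + h ^+ 2 * f ^+ 2.
    have -> : z ^+ 2 + 2 * h * (z * f) + h ^+ 2 * f ^+ 2 = (z + h * f) ^+ 2 by ring.
    exact: sqr_ge0.
  have hf := ler_wpM2l (sqr_ge0 h) Fb.
  rewrite -(ler_pM2l (_ : 0 < 2 * h)); last by rewrite mulr_gt0.
  move: Y hf z2; rewrite !expr2; nra.
move: young; rewrite HE // FE // /q !(hornerD, hornerN, hornerZ, hornerC) deriv_exp /= hornerMn.
rewrite hornerM !horner_exp /=.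
lra.
Qed.

End Piece.

(** * The scheme *)

Section Scheme.
Context {R : realType}.
Local Notation mu := (@lebesgue_measure R).
Variables (r N : nat) (a b : R) (A : nat -> R) (x : nat -> R).
Hypotheses (r_gt0 : (0 < r)%N) (A_ge0 : forall j, 0 <= A j).
Hypothesis A_exact : forall Q : {poly R}, (size Q <= r.*2.+1)%N ->
  \sum_(1 <= j < r.+1) A j * Q^`().[@gauss_ref R r j] = Q.[1] - Q.[-1].
Hypotheses (ab : a < b) (mx : is_mesh a b N x).
Variables (v : R -> R) (p : nat -> {poly R}).
Hypotheses (p_size : forall i, (size (p i) <= r.+1)%N) (p0 : p 0%N = 0).
Hypothesis vE : forall i t, (0 < i <= N)%N -> x i.-1 <= t <= x i -> v t = (p i).[t].
Hypotheses (va : v (x 0%N) = 0) (vb : v (x N) = 0).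

Let e i := pint (p i ^+ 2) (x i.-1) (x i).
Let d i := pint ((p i)^`() ^+ 2) (x i.-1) (x i).
Let energy := \sum_(1 <= i < N.+1) (e i + d i).

Definition lift i j : R := cell_coef r A (x i.-1) (x i) (p i) j.

Let cell_lt i : (0 < i <= N)%N -> x i.-1 < x i.
Proof. by case: i => //= i; have [_ _] := mx; exact. Qed.

Let cell_in i : (0 < i <= N)%N -> a <= x i.-1 /\ x i <= b.
Proof.
move=> /andP[i0 iN]; have /andP[_ ->] := mesh_bounds mx iN.
by have /andP[-> _] := mesh_bounds mx (leq_trans (leq_pred i) iN).
Qed.

Let e_ge0 i : (0 < i <= N)%N -> 0 <= e i.
Proof.
by move=> iN; apply: pint_ge0 => [|t _]; [exact/ltW/cell_lt | rewrite horner_exp sqr_ge0].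
Qed.

Let d_ge0 i : (0 < i <= N)%N -> 0 <= d i.
Proof.
by move=> iN; apply: pint_ge0 => [|t _]; [exact/ltW/cell_lt | rewrite horner_exp sqr_ge0].
Qed.

Let in_range i : (1 <= i < N.+1)%N -> (0 < i <= N)%N.
Proof. by rewrite ltnS. Qed.

Let N_gt0 : (0 < N)%N.
Proof. by case: N mx => // -[xa xb _]; move: ab; rewrite -xa -xb ltxx. Qed.

Lemma energy_ge0 : 0 <= energy.
Proof.
rewrite /energy big_nat_cond sumr_ge0 // => i /andP[/in_range iN _].
by rewrite addr_ge0 ?e_ge0 ?d_ge0.
Qed.

Let v_left i : (0 < i <= N)%N -> v (x i.-1) = (p i).[x i.-1].
Proof. by move=> iN; apply: vE => //; rewrite lexx ltW // cell_lt. Qed.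

Let v_right i : (0 < i <= N)%N -> v (x i) = (p i).[x i].
Proof. by move=> iN; apply: vE => //; rewrite lexx ltW // cell_lt. Qed.

Lemma lift0 i : (0 < i <= N)%N -> lift i 0 = v (x i.-1).
Proof. by move=> iN; rewrite /lift /cell_coef big_geq // addr0 v_left. Qed.

Lemma lift_last i : (0 < i <= N)%N -> lift i r = v (x i).
Proof. by move=> iN; rewrite /lift cell_coef_last // v_right. Qed.

(** The boundary conventions agree with the lift: [lift i 0] and the last coefficient of the
    previous cell are the same nodal value of [v], and [v] vanishes at both ends. *)
Lemma ext_coef_lift i j : (0 < i <= N)%N -> (j <= r)%N ->
  ext_coef r N lift i j = lift i j.
Proof.
move=> iN jr; rewrite /ext_coef; case: eqP => [->|_].
  case: eqP => [i1|i1]; first by rewrite lift0 // i1 va.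
  rewrite lift0 // lift_last // ; case: i iN i1 => //= -[|i] //= iN _.
  exact: ltnW.
by case: andP => [[/eqP -> /eqP ->]|//]; rewrite lift_last ?vb // N_gt0 leqnn.
Qed.

Lemma jump_lift i j : (0 < i <= N)%N -> (0 < j <= r)%N ->
  jump r N lift i j =
  cell_weight A (x i.-1) (x i) j * (p i)^`().[gauss r x i j].
Proof.
move=> iN /andP[j0 jr]; rewrite /jump !ext_coef_lift ?(leq_trans (leq_pred j)) //.
rewrite /lift /cell_coef; case: j j0 jr => // j _ jr.
rewrite big_nat_recr //= /gauss ifN; last by rewrite neq_ltn ltnS jr.
by rewrite -[gauss_in_cell _ _ _ _]/(cell_node r (x i.-1) (x i) j.+1); ring.
Qed.

Lemma derive1_trial i t : (0 < i <= N)%N -> x i.-1 < t < x i ->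
  derive1 v t = (p i)^`().[t].
Proof.
move=> iN /andP[it ti]; rewrite derivE !derive1E; symmetry; apply: near_eq_derive.
near=> s; rewrite (vE i) //; apply/andP; split; apply: ltW; near: s.
  exact: lt_nbhsr.
exact: lt_nbhsl.
Unshelve. all: by end_near. Qed.

Lemma mesh_cell t : a <= t <= b -> exists2 i, (0 < i <= N)%N & x i.-1 <= t <= x i.
Proof.
move=> /andP[at_ tb]; have ex : exists i, t <= x i by exists N; have [_ -> _] := mx.
have [i ti imin] := ex_minnP ex; have iN : (i <= N)%N by apply: imin; have [_ -> _] := mx.
case: i ti iN imin => [|i] ti iN imin.
  by exists 1%N; rewrite ?N_gt0 //=; have [xa _ xS] := mx;
    rewrite xa at_ (le_trans ti) // ltW // xS.
exists i.+1 => //=; rewrite ti andbT ltW // ltNge; apply/negP => /imin.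
by rewrite ltnn.
Qed.

Let ae_off_nodes (Q : R -> Prop) :
  (forall t, (forall k, (k <= N)%N -> t != x k) -> Q t) -> {ae mu, forall t, Q t}.
Proof.
move=> H; suff : {ae mu, forall t, forall k, (k < N.+1)%N -> t != x k}.
  by apply: filterS => t tx; apply: H => k kN; exact: tx.
exact: ae_not_nodes.
Qed.

Let interior t : a <= t <= b -> (forall k, (k <= N)%N -> t != x k) ->
  exists2 i, (0 < i <= N)%N & x i.-1 < t < x i.
Proof.
move=> /mesh_cell[i iN /andP[it ti]] tx; exists i => //.
move: (iN) => /andP[i0 iN']; rewrite !lt_neqAle it ti !andbT eq_sym !tx //.
exact: leq_trans (leq_pred i) iN'.
Qed.

Lemma trial_normE : trial_norm N x v = Num.sqrt energy.
Proof.
congr Num.sqrt; apply: eq_big_nat => i /in_range iN.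
have xi := ltW (cell_lt i iN); congr (_ + _).
  rewrite /e -Rintegral_horner //; apply: eq_Rintegral => t.
  by rewrite inE /= in_itv /= => /(vE i t iN) ->; rewrite horner_exp.
rewrite /d -Rintegral_horner //; apply: ae_eq_Rintegral.
apply: ae_off_nodes => t tx; rewrite /= in_itv /= => /andP[it ti].
move: (iN) => /andP[i0 iN'].
rewrite (derive1_trial i) ?horner_exp // !lt_neqAle it ti !andbT eq_sym !tx //.
exact: leq_trans (leq_pred i) iN'.
Qed.

(** If the energy is zero, so is that of each cell; [cell_coef_sq] then kills the coefficient of
    index 0, and [cell_coef_dist] carries this to every point of the cell. *)
Lemma energy_gt0 : trial_nonzero N x v -> 0 < energy.
Proof.
have [xa xb _] := mx.
move=> [t]; rewrite in_itv /= xa xb => tab vt; rewrite lt_neqAle energy_ge0 andbT.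
apply: contraNneq vt => energy0.
have H i : (0 < i <= N)%N -> e i = 0 /\ d i = 0.
  move=> iN; have /eqP := esym energy0; rewrite /energy big_nat_cond psumr_eq0; last first.
    by move=> k /andP[/in_range kN _]; rewrite addr_ge0 ?e_ge0 ?d_ge0.
  move=> /allP /(_ i); rewrite mem_index_iota ltnS iN => /(_ isT) /=.
  by rewrite paddr_eq0 ?e_ge0 ?d_ge0 // => /andP[/eqP ? /eqP ?].
have [i iN it] := mesh_cell t tab; rewrite (vE i) //.
have [ei di] := H i iN.
have H1 := cell_coef_sq r A r_gt0 A_ge0 A_exact (x i.-1) (x i) (p i) 0 (p_size i) (leq0n _)
  (ltW (cell_lt i iN)).
have H2 := cell_coef_dist r A r_gt0 A_ge0 A_exact (x i.-1) (x i) (p i) 0 t (p_size i)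
  (leq0n _) it.
move: H1 H2; rewrite -/(e i) -/(d i) ei di !mulr0 addr0.
rewrite pmulr_rle0 ?subr_gt0 ?cell_lt // => H1 H2.
have /eqP : cell_coef r A (x i.-1) (x i) (p i) 0 ^+ 2 = 0.
  by apply/eqP; rewrite eq_le H1 sqr_ge0.
rewrite sqrf_eq0 => /eqP W0; move: H2; rewrite W0 sub0r sqrrN => H2.
by rewrite -sqrf_eq0 eq_le H2 sqr_ge0.
Qed.

(** The jumps cost 1, as each weight is at most the cell size and the quadrature of the squared
    derivative is exact; each of the at most [r] coefficients per cell costs 8, because cells have
    length at most 1. *)
Lemma test_norm_lift : (forall i, (0 < i <= N)%N -> cell_size x i <= 1) ->
  test_norm r N x lift <= Num.sqrt ((1 + 8 * r%:R) * energy).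
Proof.
move=> h1; apply: ler_wsqrtr; rewrite /energy mulr_sumr -big_split /=.
apply: ler_sum_nat => i /in_range iN.
have hi : 0 < x i - x i.-1 by rewrite subr_gt0 cell_lt.
have jumps : \sum_(1 <= j < r.+1) (cell_size x i)^-1 * jump r N lift i j ^+ 2 <= d i.
  rewrite /d -(sum_deriv_sq r A A_exact) //.
  apply: ler_sum_nat => j; rewrite ltnS => jr.
  have w0 := cell_weight_ge0 A A_ge0 (x i.-1) (x i) j (ltW (cell_lt i iN)).
  have wh : cell_weight A (x i.-1) (x i) j <= x i - x i.-1.
    rewrite -(sum_cell_weight r A r_gt0 A_exact) (bigD1_seq j) ?mem_index_iota ?ltnS ?iota_uniq //=.
    rewrite lerDl sumr_ge0 // => k _.
    by apply: cell_weight_ge0 => //; exact/ltW/cell_lt.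
  rewrite jump_lift // /gauss ifN; last by move: jr => /andP[_ jr]; rewrite neq_ltn ltnS jr.
  rewrite -/(cell_node r (x i.-1) (x i) j); set W := cell_weight _ _ _ _ in w0 wh *.
  rewrite -[W * _]/(W * (p i)^`().[cell_node r (x i.-1) (x i) j]) exprMn mulrA.
  rewrite ler_wpM2r ?sqr_ge0 // mulrC ler_pdivrMr // expr2.
  by rewrite ler_wpM2l.
have coefs : \sum_(1 <= j < (ncoef r N i).+1) cell_size x i * lift i j ^+ 2 <=
    r%:R * (8 * (e i + d i)).
  apply: (@le_trans _ _ (\sum_(1 <= j < (ncoef r N i).+1) 8 * (e i + d i))).
    apply: ler_sum_nat => j; rewrite ltnS => /andP[j0 jr].
    have jr' : (j <= r)%N.
      by apply: leq_trans jr _; rewrite /ncoef; case: ifP => // _; exact: leq_pred.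
    have := cell_coef_sq r A r_gt0 A_ge0 A_exact (x i.-1) (x i) (p i) j (p_size i) jr'
      (ltW (cell_lt i iN)).
    rewrite -/(e i) -/(d i) -/(lift i j) => /le_trans; apply.
    have hi1 : x i - x i.-1 <= 1 := h1 i iN.
    have : (x i - x i.-1) ^+ 2 <= 1 by rewrite expr_le1 // ltW.
    have := e_ge0 i iN; have := d_ge0 i iN; nra.
  rewrite sumr_const_nat subSS subn0 -[leLHS]mulr_natl.
  apply: ler_wpM2r; first by have := e_ge0 i iN; have := d_ge0 i iN; lra.
  rewrite ler_nat.
  by rewrite /ncoef; case: ifP => // _; exact: leq_pred.
by have := e_ge0 i iN; have := d_ge0 i iN; lra.
Qed.

Lemma diffusion_lift (alpha : R -> R) alpha0 :
  (forall t, t \in `[a, b] -> alpha0 <= alpha t) ->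
  alpha0 * \sum_(1 <= i < N.+1) d i <=
  \sum_(1 <= i < N.+1) \sum_(1 <= j < r.+1)
    jump r N lift i j * (alpha (gauss r x i j) * derive1 v (gauss r x i j)).
Proof.
move=> al; rewrite mulr_sumr; apply: ler_sum_nat => i /in_range iN.
rewrite /d -(sum_deriv_sq r A A_exact) // mulr_sumr.
apply: ler_sum_nat => j; rewrite ltnS => jr; rewrite jump_lift //.
have -> : gauss r x i j = cell_node r (x i.-1) (x i) j.
  by rewrite /gauss ifN //; move: jr => /andP[_ jr]; rewrite neq_ltn ltnS jr.
set g := cell_node _ _ _ _.
have gi : x i.-1 < g < x i by apply: cell_node_bnd => //; exact: cell_lt.
rewrite (derive1_trial i) //; set y := _.[g]; set w := cell_weight _ _ _ _.
have w0 : 0 <= w by apply: cell_weight_ge0 => //; exact/ltW/cell_lt.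
have alg : alpha0 <= alpha g.
  apply: al; rewrite in_itv /=; have [? ?] := cell_in i iN.
  by move: gi => /andP[? ?]; apply/andP; split; lra.
rewrite -subr_ge0.
have -> : w * y * (alpha g * y) - alpha0 * (w * y ^+ 2) =
  (alpha g - alpha0) * (w * y ^+ 2) by ring.
by rewrite mulr_ge0 ?subr_ge0 // mulr_ge0 ?sqr_ge0.
Qed.

(** * Convection and reaction part of the form *)

Section Convection.
Variables (B G : R -> R) (M kappa : R).
Hypotheses (bB : bounded_measurable a b B) (bG : bounded_measurable a b G).
Hypotheses (BM : forall t, a <= t <= b -> `|B t| <= M).
Hypotheses (GM : forall t, a <= t <= b -> `|G t| <= M).

Let F t := B t * piecewise N x (fun k => (p k)^`()) t + G t * piecewise N x p t.
Let H t := B t * piecewise N x (fun k => (p k ^+ 2)^`()) t +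
  2 * (G t - kappa) * piecewise N x (fun k => p k ^+ 2) t.

Hypothesis H_ge0 : 0 <= \int[mu]_(t in `[a, b]) H t.

Let bF : bounded_measurable a b F.
Proof.
by apply: bounded_measurableD; apply: bounded_measurableM => //;
  exact/bounded_measurable_piecewise/ltW.
Qed.

Let bH : bounded_measurable a b H.
Proof.
apply: bounded_measurableD; apply: bounded_measurableM => //;
  try exact/bounded_measurable_piecewise/ltW.
apply: bounded_measurableM; first exact: (bounded_measurable_cst a b 2).
by apply: bounded_measurableD => //; exact: (bounded_measurable_cst a b (- kappa)).
Qed.

Let I c1 d1 : R := \int[mu]_(t in `[c1, d1]) F t.

Let I_cat c1 e1 d1 : a <= c1 -> c1 <= e1 -> e1 <= d1 -> d1 <= b ->
  I c1 d1 = I c1 e1 + I e1 d1.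
Proof. exact: Rintegral_itv_cat bF. Qed.

(** Additive in the interval, whereas the coefficient in front of [I] changes at each Gauss point:
    bounds on the pieces of a cell can therefore be added up. *)
Let lower i c1 d1 : R := 2^-1 * (\int[mu]_(t in `[c1, d1]) H t) +
  kappa * pint (p i ^+ 2) c1 d1 - 2 * d i * (d1 - c1) -
  cell_size x i * M ^+ 2 * pint ((p i)^`() ^+ 2 + p i ^+ 2) c1 d1.

Let lower_cat i c1 e1 d1 : a <= c1 -> c1 <= e1 -> e1 <= d1 -> d1 <= b ->
  lower i c1 d1 = lower i c1 e1 + lower i e1 d1.
Proof.
move=> ac ce ed db; rewrite /lower (Rintegral_itv_cat a b _ c1 e1 d1 bH) //.
by rewrite -(pint_cat (p i ^+ 2) c1 e1 d1) -(pint_cat (_ + _) c1 e1 d1); ring.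
Qed.

Let lower_le i j c1 d1 : (0 < i <= N)%N -> (j <= r)%N ->
  x i.-1 <= c1 -> c1 <= d1 -> d1 <= x i -> lower i c1 d1 <= lift i j * I c1 d1.
Proof.
move=> iN jr xc cd dx; have [ax xb] := cell_in i iN.
have inner t : c1 < t < d1 -> x i.-1 < t < x i.
  by move=> /andP[ct td]; rewrite (le_lt_trans xc ct) (lt_le_trans td dx).
apply: (piece_lower_bound a b c1 d1 (p i) B G F H M (cell_size x i) (d i)) => //.
- by rewrite subr_gt0 cell_lt.
- exact: le_trans ax xc.
- exact: le_trans dx xb.
- by move=> t /inner it; rewrite /F !(piecewiseE a b N x _ i t mx) //= ?p0 ?deriv0.
- by move=> t /inner it; rewrite /H !(piecewiseE a b N x _ i t mx) ?p0 ?expr0n ?deriv0.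
- move=> t /inner /andP[it ti]; apply: (cell_coef_dist r A r_gt0 A_ge0 A_exact) => //.
  by rewrite !ltW.
Qed.

Let g i j := cell_node r (x i.-1) (x i) j.

Let g_in i j : (0 < i <= N)%N -> (0 < j <= r)%N -> x i.-1 <= g i j /\ g i j <= x i.
Proof.
move=> iN jr; have /andP[? ?] := cell_node_bnd r _ _ j (cell_lt i iN) jr.
by split; exact: ltW.
Qed.

Let gaussE i j : (j <= r)%N -> gauss r x i j = g i j.
Proof. by move=> jr; rewrite /gauss ifN // neq_ltn ltnS jr. Qed.

Let core i : R := \sum_(1 <= j < r) lift i j * I (g i j) (g i j.+1).

(** The Gauss points cut the cell into [r + 1] pieces, carrying the coefficients from [lift i 0] to
    [lift i r]; [lower] is summed over them. *)
Let cell_sum_ge i : (0 < i <= N)%N ->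
  lower i (x i.-1) (x i) <=
  core i + lift i r * I (g i r) (x i) + lift i 0 * I (x i.-1) (g i 1).
Proof.
move=> iN; have [ax xb] := cell_in i iN; have xi := cell_lt i iN.
have r1 : (0 < 1 <= r)%N by rewrite r_gt0.
have rr : (0 < r <= r)%N by rewrite r_gt0 leqnn.
have [g1l g1r] := g_in i 1 iN r1; have [grl grr] := g_in i r iN rr.
have g1r' : g i 1 <= g i r.
  have := @leqnn r; have : (1 <= r)%N by [].
  elim: {-3}r => // -[|n] IHn _ nr; first by [].
  apply: le_trans (IHn _ (ltnW nr)) _ => //.
  by apply/ltW/cell_node_lt.
have core_ge : lower i (g i 1) (g i r) <= core i.
  have lamE c1 d1 : x i.-1 <= c1 -> c1 <= d1 -> d1 <= x i ->
      lower i c1 d1 = lower i (x i.-1) d1 - lower i (x i.-1) c1.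
    move=> xc cd dx; rewrite (lower_cat i (x i.-1) c1 d1) ?(le_trans dx) //.
    by rewrite addrAC subrr add0r.
  rewrite lamE // -(telescope_sumr (fun j => lower i (x i.-1) (g i j))) //.
  apply: ler_sum_nat => j /andP[j0 jr].
  have [? ?] : x i.-1 <= g i j /\ g i j <= x i by apply: g_in; rewrite ?j0 ?(ltnW jr).
  have [? ?] : x i.-1 <= g i j.+1 /\ g i j.+1 <= x i by apply: g_in.
  have gj : g i j <= g i j.+1 by apply/ltW/cell_node_lt; rewrite ?j0.
  by rewrite -lamE //; apply: lower_le => //; exact: ltnW.
have -> : lower i (x i.-1) (x i) =
    lower i (x i.-1) (g i 1) + lower i (g i 1) (g i r) + lower i (g i r) (x i).
  rewrite -(lower_cat i (x i.-1) (g i 1) (g i r)) ?(le_trans grr) //.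
  by rewrite -(lower_cat i (x i.-1) (g i r) (x i)).
have lowZ : lower i (x i.-1) (g i 1) <= lift i 0 * I (x i.-1) (g i 1) by exact: lower_le.
have lowX : lower i (g i r) (x i) <= lift i r * I (g i r) (x i) by exact: lower_le.
by lra.
Qed.

(** A dual interval containing the node [x i] splits there into two pieces with the same
    coefficient, since [lift i r] and [lift i.+1 0] both equal [v (x i)]. The pieces next to [a] and
    [b], which no dual interval covers, may be added because their coefficients vanish. *)
Let dual_integrals : \sum_(1 <= i < N.+1) \sum_(1 <= j < (ncoef r N i).+1)
    lift i j * I (gauss r x i j) (gauss r x i j.+1) =
  \sum_(1 <= i < N.+1)
    (core i + lift i r * I (g i r) (x i) + lift i 0 * I (x i.-1) (g i 1)).
Proof.
have rr : (0 < r <= r)%N by rewrite r_gt0 leqnn.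
have coreE i : \sum_(1 <= j < r) lift i j * I (gauss r x i j) (gauss r x i j.+1) = core i.
  by apply: eq_big_nat => j /andP[_ jr]; rewrite !gaussE // ltnW.
rewrite big_nat_recr //= /ncoef eqxx prednK // coreE.
rewrite (eq_big_nat _ _ (F2 := fun i => core i + lift i r * I (g i r) (x i) +
    lift i.+1 0 * I (x i) (g i.+1 1))); last first.
  move=> i /andP[i0 iN]; rewrite ifN; last by rewrite neq_ltn iN.
  have iN' : (0 < i <= N)%N by rewrite i0 ltnW.
  rewrite big_nat_recr //= coreE gaussE // /gauss eqxx.
  rewrite -[gauss_in_cell _ _ _ _]/(g i.+1 1).
  have [? gx] := g_in i r iN' rr.
  have [xg ?] : x i <= g i.+1 1 /\ g i.+1 1 <= x i.+1 by apply: (g_in i.+1).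
  have [? ?] := cell_in i iN'; have [? ?] := cell_in i.+1 iN.
  rewrite (I_cat (g i r) (x i)) //; try by lra.
  by rewrite mulrDr addrA lift_last // lift0.
rewrite !big_split /=.
have -> : \sum_(1 <= i < N) lift i.+1 0 * I (x i) (g i.+1 1) =
    \sum_(1 <= i < N.+1) lift i 0 * I (x i.-1) (g i 1).
  by rewrite [RHS]big_ltn ?ltnS ?N_gt0 // lift0 ?N_gt0 //= va mul0r add0r [RHS]big_add1.
rewrite [X in _ = X + _ + _]big_nat_recr //= [X in _ = _ + X + _]big_nat_recr //=.
by rewrite lift_last ?N_gt0 ?leqnn // vb mul0r addr0; ring.
Qed.

Let sum_H : \sum_(1 <= i < N.+1) \int[mu]_(t in `[x i.-1, x i]) H t =
  \int[mu]_(t in `[a, b]) H t.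
Proof.
have [xa xb _] := mx.
have -> : \sum_(1 <= i < N.+1) \int[mu]_(t in `[x i.-1, x i]) H t =
    \sum_(0 <= i < N) (\int[mu]_(t in `[a, x i.+1]) H t - \int[mu]_(t in `[a, x i]) H t).
  rewrite big_add1; apply: eq_big_nat => i /andP[_ iN] /=.
  have [? ?] := cell_in i.+1 iN; have := cell_lt i.+1 iN => /= /ltW ?.
  by rewrite (Rintegral_itv_cat a b _ a (x i) (x i.+1) bH) // addrAC subrr add0r.
rewrite (telescope_sumr (fun i => \int[mu]_(t in `[a, x i]) H t)) //.
by rewrite xb xa set_itv1 Rintegral_set1 subr0.
Qed.

(** In the factor of [h], the 2 comes from the distance between lift and [v], and [M ^+ 2] from the
    size of the integrand, as weighted by Young's inequality; the integral of [H] is dropped by its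
    sign. *)
Lemma convection_lift (beta gamma : R -> R) h :
  {ae mu, forall t, t \in `[a, b] -> beta t = B t} ->
  {ae mu, forall t, t \in `[a, b] -> gamma t = G t} ->
  (forall i, (0 < i <= N)%N -> cell_size x i <= h) ->
  kappa * \sum_(1 <= i < N.+1) e i - h * (2 + M ^+ 2) * energy <=
  \sum_(1 <= i < N.+1) \sum_(1 <= j < (ncoef r N i).+1)
    lift i j * \int[mu]_(t in `[gauss r x i j, gauss r x i j.+1])
      (beta t * derive1 v t + gamma t * v t).
Proof.
move=> betaB gammaG hx.
have FE : {ae mu, forall t, t \in `[a, b] ->
    beta t * derive1 v t + gamma t * v t = F t}.
  have : {ae mu, forall t, t \in `[a, b] -> derive1 v t =
      piecewise N x (fun k => (p k)^`()) t /\ v t = piecewise N x p t}.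
    apply: ae_off_nodes => t tx; rewrite in_itv /= => tab.
    have [i iN it] := interior t tab tx.
    rewrite !(piecewiseE a b N x _ i t mx) ?p0 ?deriv0 //.
    by rewrite (derive1_trial i) // (vE i) // !ltW; case/andP: it.
  apply: filterS3 betaB gammaG => t bt gt vt tab.
  by have [-> ->] := vt tab; rewrite bt // gt.
have dualI i j : (0 < i <= N)%N -> (0 < j <= ncoef r N i)%N ->
    \int[mu]_(t in `[gauss r x i j, gauss r x i j.+1])
      (beta t * derive1 v t + gamma t * v t) = I (gauss r x i j) (gauss r x i j.+1).
  move=> iN /andP[j0 jn]; have jr : (j <= r)%N.
    by apply: leq_trans jn _; rewrite /ncoef; case: ifP => // _; exact: leq_pred.
  apply: ae_eq_Rintegral; apply: filterS FE => t + tg; apply.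
  move: tg; rewrite /= !in_itv /= => /andP[t1 t2].
  have [? ?] := cell_in i iN.
  have [g1 g2] : x i.-1 <= gauss r x i j /\ gauss r x i j <= x i.
    by rewrite gaussE //; apply: g_in; rewrite ?j0.
  have g3 : gauss r x i j.+1 <= b.
    move: jr; rewrite leq_eqVlt => /predU1P[jr|jr]; last first.
      rewrite gaussE //; have [_] := g_in i j.+1 iN jr.
      by move=> /le_trans; apply.
    move: jn; rewrite jr /ncoef /gauss eqxx; case: eqP => [_|/eqP iN'] jn.
      by move: jn; rewrite -[X in (X <= _)%N](prednK r_gt0) ltnn.
    have iN1 : (0 < i.+1 <= N)%N.
      by move: iN => /andP[_ iN]; rewrite /= ltn_neqAle iN' iN.
    have [_] := g_in i.+1 1 iN1 r_gt0; have [_ xb] := cell_in i.+1 iN1.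
    by move=> /le_trans; apply.
  by apply/andP; split; lra.
rewrite [leRHS](eq_big_nat _ _ (F2 := fun i => \sum_(1 <= j < (ncoef r N i).+1)
    lift i j * I (gauss r x i j) (gauss r x i j.+1))); last first.
  move=> i /in_range iN; apply: eq_big_nat => j; rewrite ltnS => jr.
  by rewrite dualI.
rewrite dual_integrals.
apply: (@le_trans _ _ (\sum_(1 <= i < N.+1) lower i (x i.-1) (x i))); last first.
  by apply: ler_sum_nat => i /in_range; exact: cell_sum_ge.
apply: (@le_trans _ _ (\sum_(1 <= i < N.+1)
    (2^-1 * (\int[mu]_(t in `[x i.-1, x i]) H t) +
     (kappa * e i - h * (2 + M ^+ 2) * (e i + d i))))).
  have -> : \sum_(1 <= i < N.+1) (2^-1 * (\int[mu]_(t in `[x i.-1, x i]) H t) +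
      (kappa * e i - h * (2 + M ^+ 2) * (e i + d i))) =
      2^-1 * (\int[mu]_(t in `[a, b]) H t) +
      (kappa * \sum_(1 <= i < N.+1) e i - h * (2 + M ^+ 2) * energy).
    by rewrite -sum_H /energy !mulr_sumr -sumrB -big_split.
  by rewrite lerDr mulr_ge0.
apply: ler_sum_nat => i /in_range iN; rewrite /lower pintD -/(e i) -/(d i).
rewrite -/(cell_size x i); set s := cell_size x i.
have s0 : 0 <= s by rewrite subr_ge0 ltW ?cell_lt.
have sh : s <= h := hx i iN.
have M2 : 0 <= M ^+ 2 := sqr_ge0 M.
have := e_ge0 i iN; have := d_ge0 i iN; set ei := e i; set di := d i => d0 e0.
have : s * ((2 + M ^+ 2) * (ei + di)) <= h * ((2 + M ^+ 2) * (ei + di)).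
  by apply: ler_wpM2r => //; apply: mulr_ge0; lra.
have : 0 <= s * ei by rewrite mulr_ge0.
set J := \int[mu]_(t in _) _.
lra.
Qed.

End Convection.

(** All Gauss points in one increasing enumeration, so that the relative position of dual intervals
    is read off a single index. *)
Let z n : R := gauss_in_cell r x (n %/ r).+1 (n %% r).+1.

Let z_lt n : (n.+1 < N * r)%N -> z n < z n.+1.
Proof.
move=> nN; have := divn_eq n r; have := ltn_pmod n r_gt0.
set q := (n %/ r)%N; set m := (n %% r)%N => mr nE.
rewrite /z -/q -/m; have [m1r|m1r] := ltnP m.+1 r.
  have -> : (n.+1 %/ r)%N = q.
    by rewrite nE -addnS divnMDl // divn_small // addn0.
  have -> : (n.+1 %% r)%N = m.+1 by rewrite nE -addnS modnMDl modn_small.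
  apply: cell_node_lt => //; apply: cell_lt => /=.
  by rewrite /q ltn_divLR // ltnW.
have mE : m.+1 = r by apply/eqP; rewrite eqn_leq mr m1r.
have nE' : n.+1 = (q.+1 * r)%N by rewrite nE -addnS mE mulSn addnC.
have -> : (n.+1 %/ r)%N = q.+1 by rewrite nE' mulnK.
have -> : (n.+1 %% r)%N = 0%N by rewrite nE' modnMl.
have qN : (q.+1 < N)%N by move: nN; rewrite nE' ltn_pmul2r.
have /andP[_ z1] := cell_node_bnd r _ _ m.+1 (cell_lt q.+1 (ltnW qN)) mr.
have /andP[z2 _] := cell_node_bnd r _ _ 1 (cell_lt q.+2 qN) r_gt0.
exact: lt_trans z1 z2.
Qed.

Let z_le m n : (m <= n)%N -> (n < N * r)%N -> z m <= z n.
Proof.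
elim: n => [|n IHn]; first by rewrite leqn0 => /eqP ->.
rewrite leq_eqVlt => /predU1P[-> //|mn] nN.
exact: le_trans (IHn mn (ltnW nN)) (ltW (z_lt n nN)).
Qed.

Let idx i j := (i.-1 * r + j.-1)%N.

Let idxP i j : (0 < i <= N)%N -> (0 < j <= ncoef r N i)%N ->
  [/\ gauss r x i j = z (idx i j), gauss r x i j.+1 = z (idx i j).+1,
     ((idx i j).+1 < N * r)%N, (idx i j %/ r).+1 = i & (idx i j %% r).+1 = j].
Proof.
case: i => // i /= iN; case: j => // j /= jn.
have jr : (j < r)%N.
  by apply: leq_trans jn _; rewrite /ncoef; case: ifP => // _; exact: leq_pred.
rewrite /idx /=.
have divE : ((i * r + j) %/ r)%N = i by rewrite divnMDl // divn_small // addn0.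
have modE : ((i * r + j) %% r)%N = j by rewrite modnMDl modn_small.
split; rewrite ?divE ?modE //.
- by rewrite /z divE modE /gauss ifN // neq_ltn ltnS jr.
- rewrite /gauss eqSS; case: eqP => [jE|/eqP jE].
    have -> : (i * r + j).+1 = (i.+1 * r)%N by rewrite -addnS jE mulSn addnC.
    by rewrite /z mulnK // modnMl.
  have j1r : (j.+1 < r)%N by rewrite ltn_neqAle jE.
  by rewrite -addnS /z divnMDl // divn_small // addn0 modnMDl modn_small.
- move: jn; rewrite /ncoef; case: eqP => [<-|/eqP iN'] jn.
    by rewrite mulSn -addnS addnC ltn_add2r -[X in (_ < X)%N](prednK r_gt0).
  apply: (@leq_ltn_trans (i.+1 * r)); first by rewrite mulSn -addnS addnC leq_add2r.
  by rewrite ltn_pmul2r // ltn_neqAle iN'.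
Qed.

(** The dual intervals are closed but meet only in end points, so at the midpoint of one of them a
    single coefficient contributes. *)
Lemma test_nonzero_coef (w : nat -> nat -> R) i j : (0 < i <= N)%N ->
  (0 < j <= ncoef r N i)%N -> w i j != 0 -> test_nonzero r N x w.
Proof.
move=> iN jn wij; have [gE gE' nN di mo] := idxP i j iN jn.
set n := idx i j in gE gE' nN di mo.
pose t := 2^-1 * (z n + z n.+1).
have zn := z_lt n nN; have zt : z n < t by rewrite /t; lra.
have tz : t < z n.+1 by rewrite /t; lra.
exists t; suff -> : test_fun r N x w t = w i j by [].
rewrite /test_fun (bigD1_seq i) ?mem_index_iota ?iota_uniq ?ltnS //=.
rewrite (bigD1_seq j) ?mem_index_iota ?iota_uniq ?ltnS //=.
have term k l : (0 < k <= N)%N -> (0 < l <= ncoef r N k)%N -> (k != i) || (l != j) ->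
    w k l * \1_(`[gauss r x k l, gauss r x k l.+1]) t = 0.
  move=> kN ln kl; have [hE hE' mN dk ml] := idxP k l kN ln.
  rewrite indicE memNset ?mulr0 //= in_itv /= hE hE' => /andP[t1 t2].
  suff idxE : idx k l = n.
    have ki : k = i by rewrite -[LHS]dk -[RHS]di idxE.
    have lj : l = j by rewrite -[LHS]ml -[RHS]mo idxE.
    by move: kl; rewrite ki lj !eqxx.
  apply/eqP; rewrite eqn_leq; apply/andP; split; rewrite leqNgt; apply/negP => lt_idx.
    by have := z_le _ _ lt_idx (ltnW mN); lra.
  by have := z_le _ _ lt_idx (ltnW nN); lra.
rewrite indicE mem_set ?mulr1; last by rewrite /= in_itv /= gE gE' !ltW.
rewrite big1_seq; last first.
  move=> l /andP[lj]; rewrite mem_index_iota ltnS => ln.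
  by apply: term => //; rewrite lj orbT.
rewrite addr0 big1_seq ?addr0 // => k /andP[ki]; rewrite mem_index_iota ltnS => kN.
rewrite big1_seq // => l /andP[_]; rewrite mem_index_iota ltnS => ln.
by apply: term => //; rewrite ki.
Qed.

(** Were all coefficients zero, the jumps and hence the form would vanish. A nonzero coefficient
    makes the step function nonzero and the coefficient part of its norm positive. *)
Lemma bilinear_lift_test (alpha beta gamma : R -> R) :
  0 < bilinear_form r N x alpha beta gamma v lift ->
  test_nonzero r N x lift /\ 0 < test_norm r N x lift.
Proof.
move=> bil; have [[i [j [iN jn wij]]]|H] := pselect (exists i j,
  [/\ (0 < i <= N)%N, (0 < j <= ncoef r N i)%N & lift i j != 0]).
  split; first exact: test_nonzero_coef wij.
  rewrite /test_norm sqrtr_gt0 ltr_wpDl //.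
    rewrite big_nat_cond sumr_ge0 // => k /andP[/in_range kN _].
    rewrite sumr_ge0 // => l _.
    by rewrite mulr_ge0 ?sqr_ge0 // invr_ge0 subr_ge0 ltW // cell_lt.
  have h0 k : (0 < k <= N)%N -> 0 < cell_size x k by move=> kN; rewrite subr_gt0 cell_lt.
  rewrite (bigD1_seq i) ?mem_index_iota ?iota_uniq ?ltnS //= ltr_pwDl //; last first.
    rewrite big_seq_cond sumr_ge0 // => k; rewrite mem_index_iota ltnS => /andP[kN _].
    by rewrite sumr_ge0 // => l _; rewrite mulr_ge0 ?sqr_ge0 // ltW // h0.
  rewrite (bigD1_seq j) ?mem_index_iota ?iota_uniq ?ltnS //= ltr_pwDl //.
    by rewrite mulr_gt0 ?h0 // lt_neqAle sqr_ge0 andbT eq_sym sqrf_eq0.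
  by rewrite sumr_ge0 // => l _; rewrite mulr_ge0 ?sqr_ge0 // ltW // h0.
have w0 i j : (0 < i <= N)%N -> (0 < j <= ncoef r N i)%N -> lift i j = 0.
  by move=> iN jn; apply/eqP; apply: contrapT => /negP wij; apply: H; exists i, j.
have ext0 i j : (0 < i <= N)%N -> (j <= r)%N -> ext_coef r N lift i j = 0.
  move=> iN jr; rewrite /ext_coef; case: eqP => [_|/eqP j0].
    case: eqP => // /eqP i1; apply: w0.
      by case: i iN i1 => [|[|i]] //= /ltnW.
    rewrite r_gt0 /ncoef ifN //=; case: i iN i1 => [|[|i]] //= iN _.
    by rewrite neq_ltn iN.
  case: ifPn => // ijN; apply: w0 => //; rewrite lt0n j0 /ncoef /=.
  move: ijN; rewrite negb_and; case: eqP => //= _ jr'.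
  by rewrite -ltnS prednK // ltn_neqAle jr' jr.
suff : bilinear_form r N x alpha beta gamma v lift = 0 by move=> b0; move: bil; rewrite b0 ltxx.
rewrite /bilinear_form big1_seq ?add0r ?big1_seq // => i /andP[_];
  rewrite mem_index_iota ltnS => iN; rewrite big1_seq // => j /andP[_];
  rewrite mem_index_iota ltnS => jn.
  by rewrite w0 // mul0r.
move: jn => /andP[j0 jn].
by rewrite /jump !ext0 ?subr0 ?mul0r // (leq_trans (leq_pred j)).
Qed.

End Scheme.

(** With [E] the squared trial norm and [m] the minimum of [alpha0] and [kappa], the form is at
    least [m * E] minus an error of at most [m / 2 * E], while the product of the norms is at most
    [sqrt(1 + 8 r) * E]. *)
Lemma scheme_inf_sup (R : realType) (r : nat) (a b : R)
    (alpha beta beta' gamma B G : R -> R) (M alpha0 kappa h : R) N (x : nat -> R) :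
  (0 < r)%N -> a < b -> weak_derivative a b beta beta' ->
  bounded_measurable a b B -> bounded_measurable a b G ->
  (forall t, a <= t <= b -> `|B t| <= M) -> (forall t, a <= t <= b -> `|G t| <= M) ->
  {ae (@lebesgue_measure R), forall t, t \in `[a, b] -> beta t = B t} ->
  {ae (@lebesgue_measure R), forall t, t \in `[a, b] -> gamma t = G t} ->
  (forall t, t \in `[a, b] -> alpha0 <= alpha t) ->
  {ae (@lebesgue_measure R), forall t, t \in `]a, b[ ->
     kappa <= gamma t - 2^-1 * beta' t} ->
  0 < alpha0 -> 0 < kappa -> h <= 1 -> h * (2 + M ^+ 2) <= Num.min alpha0 kappa / 2 ->
  is_mesh a b N x -> mesh_size N x <= h ->
  ((Num.min alpha0 kappa / 2 / Num.sqrt (1 + 8 * r%:R))%:E <=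
    inf_sup r N x alpha beta gamma)%E.
Proof.
move=> r0 ab wd bB bG BM GM betaB gammaG al kap alpha0_gt0 kappa_gt0 h1 hM mx xh.
set m := Num.min alpha0 kappa; have m0 : 0 < m by rewrite /m lt_min alpha0_gt0.
have [A [A0 A_exact]] := @gauss_quadrature R r r0.
have [xa xb _] := mx.
have cell_h i : (0 < i <= N)%N -> cell_size x i <= h.
  move=> iN; apply: le_trans xh; rewrite /mesh_size.
  have ir : i \in index_iota 1 N.+1 by rewrite mem_index_iota ltnS.
  by apply: bigmax_sup_seq ir _ _.
apply: le_ereal_inf_tmp => _ [v [[_ vp va vb] vn0] <-].
(* Extending the family by 0 outside the range 1..N provides the zero pieces before and after the
   mesh that the smoothing expects. *)
have local_poly i : exists q : {poly R}, (size q <= r.+1)%N /\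
    if (0 < i <= N)%N then {in `[x i.-1, x i], forall t, v t = q.[t]} else q = 0.
  have [/vp[q sq vq]|_] := boolP (0 < i <= N)%N; first by exists q.
  by exists 0; rewrite size_poly0.
have [p pP] := choice local_poly.
have p_size i : (size (p i) <= r.+1)%N by have [] := pP i.
have p0 : p 0%N = 0 by have [_] := pP 0%N.
have pN : p N.+1 = 0 by have [_] := pP N.+1; rewrite ltnn.
have vE i t : (0 < i <= N)%N -> x i.-1 <= t <= x i -> v t = (p i).[t].
  by move=> iN it; have [_] := pP i; rewrite iN; apply; rewrite in_itv.
have xS i : (0 < i <= N)%N -> x i.-1 < x i.
  by case: i => //= i; have [_ _] := mx; exact.
have P_cont k : (k <= N)%N -> (p k.+1 ^+ 2).[x k] = (p k ^+ 2).[x k].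
  move=> kN; rewrite !horner_exp; congr (_ ^+ 2).
  have -> : (p k.+1).[x k] = v (x k).
    move: kN; rewrite leq_eqVlt => /predU1P[->|kN]; first by rewrite pN horner0 vb.
    by rewrite (vE k.+1) //= lexx ltW // (xS k.+1).
  case: k kN => [|k] kN; first by rewrite p0 horner0 va.
  by rewrite (vE k.+1) //= lexx ltW // (xS k.+1).
have P_ge0 k t : 0 <= (p k ^+ 2).[t] by rewrite horner_exp sqr_ge0.
have sq0 i : p i = 0 -> p i ^+ 2 = 0 by move=> ->; rewrite expr0n.
have H_ge0 := weak_derivative_piecewise_ge0 a b N x (fun k => p k ^+ 2) ab mx
  (sq0 _ p0) (sq0 _ pN) P_cont P_ge0 beta beta' gamma B G kappa wd bB bG betaB gammaG kap.
pose d i := pint ((p i)^`() ^+ 2) (x i.-1) (x i).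
pose e i := pint (p i ^+ 2) (x i.-1) (x i).
set E := \sum_(1 <= i < N.+1) (pint (p i ^+ 2) (x i.-1) (x i) +
  pint ((p i)^`() ^+ 2) (x i.-1) (x i)).
have normE : trial_norm N x v = Num.sqrt E.
  exact: trial_normE mx _ _ vE.
have E_gt0 : 0 < E := energy_gt0 r N a b A x r0 A0 A_exact ab mx v p p_size vE vn0.
pose w := lift r A x p.
have test_le : test_norm r N x w <= Num.sqrt ((1 + 8 * r%:R) * E).
  apply: (test_norm_lift r N a b A x r0 A0 A_exact ab mx v p p_size vE va vb) => i iN.
  exact: le_trans (cell_h i iN) h1.
have diff := diffusion_lift r N a b A x A0 A_exact ab mx v p p_size vE va vb
  alpha alpha0 al.
have conv := convection_lift r N a b A x r0 A0 A_exact ab mx v p p_size p0 vE va vb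
  B G M kappa bB bG BM GM H_ge0 beta gamma h betaB gammaG cell_h.
have bil : m / 2 * E <= bilinear_form r N x alpha beta gamma v w.
  have := lerD diff conv; apply: le_trans.
  rewrite -/E.
  have H1 : h * (2 + M ^+ 2) * E <= m / 2 * E by rewrite ler_wpM2r // ltW.
  have H2 : m * E <= alpha0 * \sum_(1 <= i < N.+1) d i + kappa * \sum_(1 <= i < N.+1) e i.
    rewrite /E !mulr_sumr -big_split /=; apply: ler_sum_nat => i; rewrite ltnS => iN.
    have ei : 0 <= e i.
      by apply: pint_ge0 => [|t _]; [exact/ltW/xS | rewrite horner_exp sqr_ge0].
    have di : 0 <= d i.
      by apply: pint_ge0 => [|t _]; [exact/ltW/xS | rewrite horner_exp sqr_ge0].
    have ma : m <= alpha0 by rewrite /m ge_min lexx.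
    have mk : m <= kappa by rewrite /m ge_min lexx orbT.
    rewrite -/(e i) -/(d i) mulrDr addrC.
    by rewrite lerD // ler_wpM2r.
  by move: H1 H2; rewrite /d /e; lra.
have bil_gt0 : 0 < bilinear_form r N x alpha beta gamma v w.
  by apply: lt_le_trans bil; rewrite mulr_gt0 // divr_gt0.
have [w_n0 w_gt0] : test_nonzero r N x w /\ 0 < test_norm r N x w.
  exact: (bilinear_lift_test r N a b A x r0 mx v p alpha beta gamma).
apply: le_ereal_sup_tmp; exists (bilinear_form r N x alpha beta gamma v w /
  (trial_norm N x v * test_norm r N x w))%:E; first by exists w.
have c0 : 0 < 1 + 8 * r%:R :> R by rewrite ltr_wpDr // mulr_ge0.
have sE : 0 < Num.sqrt E by rewrite sqrtr_gt0.
rewrite lee_fin normE ler_pdivlMr; last by rewrite mulr_gt0.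
apply: le_trans bil; move: test_le; rewrite sqrtrM ?(ltW c0) // => test_le.
have sc : 0 < Num.sqrt (1 + 8 * r%:R) :> R by rewrite sqrtr_gt0.
rewrite -[leLHS]mulrA ler_wpM2l ?divr_ge0 ?(ltW m0) //.
rewrite mulrC ler_pdivrMr //.
apply: le_trans (ler_wpM2l (ltW sE) test_le) _.
by rewrite mulrCA -expr2 sqr_sqrtr ?(ltW E_gt0) // mulrC.
Qed.

Theorem theorem3p1 (R : realType) (r : nat) (a b : R) :
  (1 <= r)%N -> a < b ->
  exists c0 : R -> R -> R,
    (forall alpha0 kappa : R, 0 < alpha0 -> 0 < kappa -> 0 < c0 alpha0 kappa) /\
    forall alpha beta beta' gamma : R -> R,
      Linfty a b alpha -> Linfty a b beta -> Linfty a b gamma ->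
      weak_derivative a b beta beta' ->
      exists2 h0 : R, 0 < h0 &
        forall alpha0 kappa : R, 0 < alpha0 -> 0 < kappa ->
          (forall t, t \in `[a, b] -> alpha0 <= alpha t) ->
          {ae (@lebesgue_measure R), forall t, t \in `]a, b[ ->
             kappa <= gamma t - 2^-1 * beta' t} ->
          forall (N : nat) (x : nat -> R),
            is_mesh a b N x -> mesh_size N x <= h0 ->
            ((c0 alpha0 kappa)%:E <= inf_sup r N x alpha beta gamma)%E.
Proof.
move=> r0 ab; pose s : R := Num.sqrt (1 + 8 * r%:R).
have s0 : 0 < s by rewrite sqrtr_gt0 ltr_wpDr // mulr_ge0.
(* One factor 1/2 pays for the [O(h)] error, the other for the nearly optimal pair chosen below. *)
exists (fun alpha0 kappa => Num.min alpha0 kappa / 4 / s); split.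
  by move=> alpha0 kappa a0 k0; rewrite !divr_gt0 // lt_min a0.
move=> alpha beta beta' gamma _ Lbeta Lgamma wd.
have [B bB betaB] := Linfty_representative a b beta Lbeta.
have [G bG gammaG] := Linfty_representative a b gamma Lgamma.
have [M [BM GM]] : exists M, (forall t, a <= t <= b -> `|B t| <= M) /\
    (forall t, a <= t <= b -> `|G t| <= M).
  have [_ [CB BC]] := bB; have [_ [CG GC]] := bG.
  by exists (Num.max CB CG); split=> t tab; rewrite le_max ?BC ?GC ?orbT.
pose admissible m := exists alpha0 kappa, [/\ 0 < alpha0, 0 < kappa,
  forall t, t \in `[a, b] -> alpha0 <= alpha t,
  {ae (@lebesgue_measure R), forall t, t \in `]a, b[ ->
     kappa <= gamma t - 2^-1 * beta' t} & m = Num.min alpha0 kappa].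
(* Without any admissible pair the claim is vacuous and every threshold works. *)
have [[m0 adm0]|none] := pselect (exists m, admissible m); last first.
  exists 1 => // alpha0 kappa a0 k0 al kap; exfalso; apply: none.
  by exists (Num.min alpha0 kappa), alpha0, kappa.
have adm_gt0 m : admissible m -> 0 < m.
  by move=> [alpha0 [kappa [a0 k0 _ _ ->]]]; rewrite lt_min a0.
(* Some admissible [m1] is at least half of every other one: the threshold
   may not depend on the pair [(alpha0, kappa)], so it is fixed by [m1]. *)
have [m1 [adm1 m1_max]] : exists m1, admissible m1 /\ forall m, admissible m -> m <= 2 * m1.
  have supA : has_sup admissible.
    split; first by exists m0.
    exists (alpha a) => m [alpha0 [kappa [_ _ al _ ->]]].
    by rewrite ge_min al // in_itv /= lexx ltW.
  have ub m : admissible m -> m <= sup admissible by apply: sup_upper_bound.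
  have half_gt0 : 0 < sup admissible / 2.
    by rewrite divr_gt0 // (lt_le_trans (adm_gt0 _ adm0)) // ub.
  have [m1 adm1 m1s] := sup_adherent half_gt0 supA.
  by exists m1; split=> // m /ub; lra.
have M0 : 0 < 2 + M ^+ 2 by rewrite ltr_wpDr ?sqr_ge0.
exists (Num.min 1 (m1 / 2 / (2 + M ^+ 2))).
  by rewrite lt_min ltr01 !divr_gt0 // adm_gt0.
move=> alpha0 kappa a0 k0 al kap N x mx xh.
have m_le : Num.min alpha0 kappa <= 2 * m1 by apply: m1_max; exists alpha0, kappa.
have [alpha1 [kappa1 [a1 k1 al1 kap1 m1E]]] := adm1.
(* The estimate is used for the pair that defines [m1], whose constant dominates the one claimed for
   the given pair. *)
apply: le_trans (scheme_inf_sup R r a b alpha beta beta' gamma B G M alpha1 kappa1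
  (Num.min 1 (m1 / 2 / (2 + M ^+ 2))) N x r0 ab wd bB bG BM GM betaB gammaG al1 kap1
  a1 k1 _ _ mx xh).
- by rewrite lee_fin -m1E -/s ler_wpM2r ?invr_ge0 ?(ltW s0) //; lra.
- by rewrite ge_min lexx.
- by rewrite -m1E -ler_pdivlMr // ge_min lexx orbT.
Qed.
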